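(* Let $S$ be an infinite discrete cancellative semigroup, let $\omega$ be a weight on $S$, and let $\mathcal A=l^1(S,\omega)$. The following are equivalent: (1) $\mathcal A$ is amenable; (2) $\mathcal A$ is Connes-amenable as a dual Banach algebra with predual $c_0(S)$. If moreover $\mathcal A$ is Arens regular, then (1) and (2) are also equivalent to: $\mathcal A''$ (with the Arens product and predual $\mathcal A'$) is Connes-amenable. Finally, these equivalent conditions imply that $S$ is a group.
   Context: A weight on a semigroup $S$ is a function $\omega:S\to(0,\infty)$ with $\omega(st)\le\omega(s)\omega(t)$ for all $s,t\in S$ (and $\omega(u_S)=1$ if $S$ has a unit $u_S$). Put $\Omega(g,h)=\omega(gh)\omega(g)^{-1}\omega(h)^{-1}$. The Banach algebra $l^1(S,\omega)$ is the Banach space $l^1(S)$ (norm $\sum_g|x_g|$, unit vectors $\delta_g$) with the product determined by $\delta_g\star\delta_h=\Omega(g,h)\delta_{gh}$ (this is isometrically isomorphic to the usual weighted convolution algebra). Its dual is $l^\infty(S)$ with $\langle f,\delta_g\rangle=f_g$, and $c_0(S)\subseteq l^\infty(S)$. $S$ is cancellative if $t\mapsto st$ and $t\mapsto ts$ are injective for each $s$; in this case $c_0(S)$ is a sub-bimodule of $l^\infty(S)=\mathcal A'$ and $\mathcal A$ is a dual Banach algebra with predual $c_0(S)$. A dual Banach algebra is a Banach algebra $\mathcal A$ together with a closed subspace $\mathcal A_*\subseteq\mathcal A'$ which is a sub-bimodule of $\mathcal A'$ (for the actions $\langle a\cdot\mu,b\rangle=\mu(ba)$, $\langle\mu\cdot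 a,b\rangle=\mu(ab)$) such that the canonical map $\mathcal A\to(\mathcal A_* )'$ is an isomorphism of Banach spaces; $\sigma(\mathcal A,\mathcal A_* )$ denotes the resulting weak$^*$ topology. $\mathcal A$ is Connes-amenable if for every Banach $\mathcal A$-bimodule $E$ such that, for each $\mu\in E'$, the maps $a\mapsto a\cdot\mu$ and $a\mapsto\mu\cdot a$ are $\sigma(\mathcal A,\mathcal A_* )$–$\sigma(E',E)$ continuous, every $\sigma(\mathcal A,\mathcal A_* )$–$\sigma(E',E)$ continuous derivation $d:\mathcal A\to E'$ is inner. The first and second Arens products on $\mathcal A''$ are defined by $\langle\Phi\Box\Psi,\mu\rangle=\langle\Phi,\Psi\cdot\mu\rangle$, $\langle\Phi\Diamond\Psi,\mu\rangle=\langle\Psi,\mu\cdot\Phi\rangle$ where $\langle\Phi\cdot\mu,a\rangle=\langle\Phi,\mu\cdot a\rangle$, $\langle\mu\cdot\Phi,a\rangle=\langle\Phi,a\cdot\mu\rangle$; $\mathcal A$ is Arens regular if they coincide, in which case $\mathcal A''$ is a dual Banach algebra with predual $\mathcal A'$. *)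

(* Defs.v *)
From HB Require Import structures.
From mathcomp Require Import all_boot all_algebra.
From mathcomp Require Import all_classical all_reals all_analysis.
From mathcomp Require Import complex.
Set Implicit Arguments. Unset Strict Implicit. Unset Printing Implicit Defensive.
Import GRing.Theory Num.Theory.
Local Open Scope classical_set_scope.
Local Open Scope ring_scope.
Local Open Scope complex_scope.

Section Defs.
Variable R : realType.
Local Notation C := R[i].
Local Notation absc := (@Normc.normc R).

Record BAlg := {
  car : Type;
  mem : car -> Prop;
  badd : car -> car -> car;
  bscale : C -> car -> car;
  bmul : car -> car -> car;
  bnorm : car -> R }.

Definition is_bimodule (B : BAlg) (E : completeNormedModType C)
    (la : car B -> E -> E) (ra : E -> car B -> E) : Prop :=
  [/\ (forall a b x, mem a -> mem b ->
         la (badd a b) x = la a x + la b x /\ ra x (badd a b) = ra x a + ra x b),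
      (forall c a x, mem a ->
         la (bscale c a) x = c *: la a x /\ ra x (bscale c a) = c *: ra x a),
      (forall a x y, mem a ->
         la a (x + y) = la a x + la a y /\ ra (x + y) a = ra x a + ra y a),
      (forall a c x, mem a ->
         la a (c *: x) = c *: la a x /\ ra (c *: x) a = c *: ra x a)
    & (exists k : R, forall a x, mem a ->
         `|la a x| <= (k * bnorm a)%:C * `|x| /\ `|ra x a| <= (k * bnorm a)%:C * `|x|)]
  /\ (forall a b x, mem a -> mem b ->
         [/\ la (bmul a b) x = la a (la b x),
             ra x (bmul a b) = ra (ra x a) b
           & la a (ra x b) = ra (la a x) b]).

Definition is_dual (E : normedModType C) (phi : E -> C) : Prop :=
  [/\ (forall x y, phi (x + y) = phi x + phi y),
      (forall (c : C) x, phi (c *: x) = c * phi x)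
    & exists k : R, forall x, `|phi x| <= k%:C * `|x|].

Definition dl (B : BAlg) (E : completeNormedModType C) (ra : E -> car B -> E)
  (a : car B) (phi : E -> C) : E -> C := fun x => phi (ra x a).
Definition dr (B : BAlg) (E : completeNormedModType C) (la : car B -> E -> E)
  (phi : E -> C) (a : car B) : E -> C := fun x => phi (la a x).

Definition is_derivation (B : BAlg) (E : completeNormedModType C)
    (la : car B -> E -> E) (ra : E -> car B -> E) (D : car B -> E -> C) : Prop :=
  [/\ (forall a, mem a -> is_dual (D a)),
      (forall a b, mem a -> mem b -> D (badd a b) = (fun x => D a x + D b x)),
      (forall c a, mem a -> D (bscale c a) = (fun x => c * D a x))
    & (forall a b, mem a -> mem b ->
         D (bmul a b) = (fun x => dl ra a (D b) x + dr la (D a) b x))].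

Definition bounded_der (B : BAlg) (E : completeNormedModType C)
    (D : car B -> E -> C) : Prop :=
  exists k : R, forall a x, mem a -> `|D a x| <= (k * bnorm a)%:C * `|x|.

Definition is_inner (B : BAlg) (E : completeNormedModType C)
    (la : car B -> E -> E) (ra : E -> car B -> E) (D : car B -> E -> C) : Prop :=
  exists phi : E -> C, is_dual phi /\
    forall a, mem a -> D a = (fun x => dl ra a phi x - dr la phi a x).

Definition amenable (B : BAlg) : Prop :=
  forall (E : completeNormedModType C) (la : car B -> E -> E) (ra : E -> car B -> E),
    is_bimodule la ra ->
    forall D : car B -> E -> C, is_derivation la ra D -> bounded_der D ->
      is_inner la ra D.

(* sigma(B, P) - sigma(E', E) continuity of a map T : B -> E', where the *)
(* predual P is given as a set of functionals on B: continuity at every *)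
(* point for the initial (weak) topologies, via basic neighbourhoods.    *)
Definition wcont (B : BAlg) (P : set (car B -> C)) (E : completeNormedModType C)
    (T : car B -> E -> C) : Prop :=
  forall a0, mem a0 ->
  forall (n : nat) (xs : 'I_n -> E) (e : R), 0 < e ->
  exists (m : nat) (ps : 'I_m -> car B -> C) (d : R),
    [/\ 0 < d, (forall i, P (ps i))
      & forall a, mem a -> (forall i, `|ps i a - ps i a0| < d%:C) ->
          forall j, `|T a (xs j) - T a0 (xs j)| < e%:C].

Definition connes_amenable (B : BAlg) (P : set (car B -> C)) : Prop :=
  forall (E : completeNormedModType C) (la : car B -> E -> E) (ra : E -> car B -> E),
    is_bimodule la ra ->
    (forall phi : E -> C, is_dual phi ->
       wcont P (fun a => dl ra a phi) /\ wcont P (fun a => dr la phi a)) ->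
    forall D : car B -> E -> C, is_derivation la ra D -> wcont P D ->
      is_inner la ra D.

Variable S : choiceType.

Definition cancellative (op : S -> S -> S) : Prop :=
  forall s, injective (op s) /\ injective (fun t => op t s).

Definition is_unit (op : S -> S -> S) (u : S) : Prop :=
  forall s, op u s = s /\ op s u = s.

Definition is_weight (op : S -> S -> S) (w : S -> R) : Prop :=
  [/\ (forall s, 0 < w s),
      (forall s t, w (op s t) <= w s * w t)
    & (forall u, is_unit op u -> w u = 1)].

Definition is_group (op : S -> S -> S) : Prop :=
  exists e, is_unit op e /\ forall s, exists t, op s t = e /\ op t s = e.

Definition Omega (op : S -> S -> S) (w : S -> R) (g h : S) : R :=
  w (op g h) / (w g * w h).

Definition sumR (T : choiceType) (D : set T) (u : T -> R) : R :=
  fine (\esum_(i in D) (Num.max (u i) 0)%:E)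
  - fine (\esum_(i in D) (Num.max (- u i) 0)%:E).

Definition sumC (T : choiceType) (D : set T) (f : T -> C) : C :=
  (sumR D (fun i => complex.Re (f i))) +i* (sumR D (fun i => complex.Im (f i))).

Definition summable (x : S -> C) : Prop :=
  (\esum_(g in [set: S]) (absc (x g))%:E < +oo)%E.

Definition l1norm (x : S -> C) : R := fine (\esum_(g in [set: S]) (absc (x g))%:E).

Definition delta (g : S) : S -> C := fun h => if h == g then 1 else 0.

Definition conv (op : S -> S -> S) (w : S -> R) (x y : S -> C) : S -> C :=
  fun k => sumC [set p : S * S | op p.1 p.2 = k]
                (fun p => (Omega op w p.1 p.2)%:C * x p.1 * y p.2).

Definition l1alg (op : S -> S -> S) (w : S -> R) : BAlg := {|
  car := S -> C;
  mem := summable;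
  badd := fun x y g => x g + y g;
  bscale := fun c x g => c * x g;
  bmul := conv op w;
  bnorm := l1norm |}.

(* duality between l^infty(S) = A' and l^1(S) = A *)
Definition pair (mu x : S -> C) : C := sumC [set: S] (fun g => mu g * x g).

Definition c0 (f : S -> C) : Prop :=
  forall e : R, 0 < e -> finite_set [set g | e <= absc (f g)].

Definition c0_predual : set ((S -> C) -> C) :=
  [set psi | exists f, c0 f /\ psi = pair f].

Definition bounded (mu : S -> C) : Prop := exists k : R, forall g, absc (mu g) <= k.

(* A' as A-bimodule: (mu.a)(b) = mu(ab), (a.mu)(b) = mu(ba), in coefficients *)
Definition dotr (op : S -> S -> S) (w : S -> R) (mu a : S -> C) : S -> C :=
  fun g => pair mu (conv op w a (delta g)).
Definition dotl (op : S -> S -> S) (w : S -> R) (a mu : S -> C) : S -> C :=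
  fun g => pair mu (conv op w (delta g) a).

(* A'' : bounded linear functionals on l^infty(S) (normalised to 0 off l^infty) *)
Definition bidual_mem (Phi : (S -> C) -> C) : Prop :=
  [/\ (forall mu, ~ bounded mu -> Phi mu = 0),
      (forall mu nu, bounded mu -> bounded nu -> Phi (fun g => mu g + nu g) = Phi mu + Phi nu),
      (forall c mu, bounded mu -> Phi (fun g => c * mu g) = c * Phi mu)
    & exists k : R, forall mu (k' : R), (forall g, absc (mu g) <= k') ->
        absc (Phi mu) <= k * k'].

Definition bidual_norm (Phi : (S -> C) -> C) : R :=
  sup [set absc (Phi mu) | mu in [set mu | forall g, absc (mu g) <= 1]].

(* (Psi.mu)(a) = Psi(mu.a),  (mu.Phi)(a) = Phi(a.mu) *)
Definition bdotr (op : S -> S -> S) (w : S -> R) (Psi : (S -> C) -> C) (mu : S -> C)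
  : S -> C := fun g => Psi (dotr op w mu (delta g)).
Definition bdotl (op : S -> S -> S) (w : S -> R) (mu : S -> C) (Phi : (S -> C) -> C)
  : S -> C := fun g => Phi (dotl op w (delta g) mu).

Definition arens1 (op : S -> S -> S) (w : S -> R) (Phi Psi : (S -> C) -> C)
  : (S -> C) -> C :=
  fun mu => if `[< bounded mu >] then Phi (bdotr op w Psi mu) else 0.
Definition arens2 (op : S -> S -> S) (w : S -> R) (Phi Psi : (S -> C) -> C)
  : (S -> C) -> C :=
  fun mu => if `[< bounded mu >] then Psi (bdotl op w mu Phi) else 0.

Definition arens_regular (op : S -> S -> S) (w : S -> R) : Prop :=
  forall Phi Psi, bidual_mem Phi -> bidual_mem Psi -> arens1 op w Phi Psi = arens2 op w Phi Psi.

Definition bidual (op : S -> S -> S) (w : S -> R) : BAlg := {|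
  car := (S -> C) -> C;
  mem := bidual_mem;
  badd := fun Phi Psi mu => Phi mu + Psi mu;
  bscale := fun c Phi mu => c * Phi mu;
  bmul := arens1 op w;
  bnorm := bidual_norm |}.

Definition bidual_predual : set (((S -> C) -> C) -> C) :=
  [set psi | exists mu, bounded mu /\ psi = (fun Phi => Phi mu)].

End Defs.

Arguments amenable {R} B.
Arguments connes_amenable {R} B P.
Arguments c0_predual R S : clear implicits.
Arguments bidual_predual R S : clear implicits.

(* Main.v *)
(**
  Write delta_k for the unit vectors of A = l^1(S, omega).  Suppose that A is
  Connes-amenable.  Bounded bilinear forms on A which, as functions of (g, h), vanish
  at infinity along the fibres of (g, h) |-> gh form a Banach A-bimodule E whose dual
  is normal: for a form x on a single fibre, cancellativity makes the supports of the
  translates x.delta_k pairwise disjoint, so that k |-> <phi, x.delta_k> is summable for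
  every phi in E'.  With the Hochschild-twisted left action, evaluation
  x |-> x(1, k) is a weak*-continuous derivation into E'; its being inner first gives a
  unit of S, and then a functional M on fibrewise vanishing forms that commutes with the
  translations and sends the pull-back of the indicator of the unit to 1.  Testing M on
  forms over the fibre of k shows that k is invertible.  For a bounded derivation D, the
  function (g, h) |-> <D(delta_h), x.delta_g> cut down to gh = 1 lives on one fibre, so M
  may be applied to it; this averages D into a functional implementing it.  No Folner
  condition and no bound on omega(g) omega(g^-1) is needed.

  Conversely, amenability of A passes to Connes-amenability of any dual Banach algebra
  in which A has weak*-dense image (A itself, or A''), since weak*-continuous
  derivations are bounded by the uniform boundedness principle.  Finally restriction to
  c_0(S) is a weak*-continuous homomorphism from A'' onto A, so that Connes-amenability
  of A'' implies that of A.
*)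
From HB Require Import structures.
Require Import Defs.
From mathcomp Require Import all_boot all_order all_algebra.
From mathcomp Require Import all_classical all_reals all_analysis.
From mathcomp Require Import complex.
From mathcomp Require Import ring lra.
Set Implicit Arguments. Unset Strict Implicit. Unset Printing Implicit Defensive.
Import Order.TTheory GRing.Theory Num.Theory Normc.
Import numFieldNormedType.Exports.
Local Open Scope classical_set_scope.
Local Open Scope ring_scope.
Local Open Scope complex_scope.

(** * Absolutely convergent sums *)

Section Sums.
Variable R : realType.
Local Notation C := R[i].

(** The choice of module is forced from two sides. Forms in [c_0(S x S)] do not in general include
    the pull-back of the indicator of the unit, which lives on the possibly infinite fibre [gh = 1];
    with all bounded forms the dual is in general not normal. Decay across the fibres, and none
    inside a fibre, reconciles the two demands. The twist of the left action comes from the search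
    for [M]. The functional [y |-> y(1, 1)] has the right normalisation but fails to commute with
    translation by [k], the defect being [y(k, 1) - y(1, k)]. This defect vanishes on forms that
    factor through the multiplication, so it lives on the quotient by them. Subtracting
    [Omega(g, h) y(gh, 1)] from [y(g, h)] gives a concrete model of that quotient, and on it the
    untwisted left translation becomes the twisted one, while the defect becomes minus the value at
    [(1, k)]. An implementing functional for the derivation is then exactly the correction to
    [y(1, 1)]. A formally adjoined unit makes the twisted module available before [S] is known to
    have one. *)

Lemma normc_ge0 (z : C) : 0 <= normc z.
Proof. by case: z => a b; rewrite /normc sqrtr_ge0. Qed.

Lemma normC_E (z : C) : `|z| = (normc z)%:C.
Proof. by []. Qed.

Lemma normcR (r : R) : normc (r%:C) = `|r|.
Proof. by rewrite /normc/= expr0n/= addr0 sqrtr_sqr. Qed.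

Lemma absRe_le (z : C) : `|complex.Re z| <= normc z.
Proof.
by case: z => a b; rewrite -sqrtr_sqr ler_wsqrtr//= lerDl sqr_ge0.
Qed.

Lemma absIm_le (z : C) : `|complex.Im z| <= normc z.
Proof.
by case: z => a b; rewrite -sqrtr_sqr ler_wsqrtr//= lerDr sqr_ge0.
Qed.

Lemma normc_leReIm (z : C) : normc z <= `|complex.Re z| + `|complex.Im z|.
Proof.
case: z => a b /=.
rewrite -[leRHS]ger0_norm ?addr_ge0// -sqrtr_sqr ler_wsqrtr//.
by rewrite sqrrD !real_normK ?num_real// lerD2r lerDl mulrn_wge0// mulr_ge0.
Qed.

Section gen.
Variables (T : choiceType).
Implicit Types (D : set T) (p q : T -> R) (f g : T -> C).

Definition has_nsum D p := (\esum_(i in D) (p i)%:E < +oo)%E.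
Definition nsum D p : R := fine (\esum_(i in D) (p i)%:E).

Lemma nsumE D p : (forall i, 0 <= p i) -> has_nsum D p ->
  (\esum_(i in D) (p i)%:E)%E = (nsum D p)%:E.
Proof.
move=> p0 hp; rewrite /nsum fineK// ge0_fin_numE//.
by apply: esum_ge0 => i _; rewrite lee_fin.
Qed.

Lemma nsum_ge0 D p : (forall i, 0 <= p i) -> 0 <= nsum D p.
Proof. by move=> p0; apply/fine_ge0/esum_ge0 => i _; rewrite lee_fin. Qed.

Lemma le_has_nsum D p q : (forall i, p i <= q i) -> has_nsum D q -> has_nsum D p.
Proof. by move=> pq; apply: le_lt_trans; apply: le_esum => i _; rewrite lee_fin. Qed.

Lemma le_nsum D p q : (forall i, 0 <= p i) -> (forall i, p i <= q i) ->
  has_nsum D q -> nsum D p <= nsum D q.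
Proof.
move=> p0 pq hq; have q0 i : 0 <= q i by exact: le_trans (pq i).
have hp : has_nsum D p by exact: le_has_nsum hq.
by rewrite -lee_fin -!nsumE//; apply: le_esum => i _; rewrite lee_fin.
Qed.

Lemma has_nsumD D p q : (forall i, 0 <= p i) -> (forall i, 0 <= q i) ->
  has_nsum D p -> has_nsum D q -> has_nsum D (fun i => p i + q i).
Proof.
move=> p0 q0 hp hq; rewrite /has_nsum.
under eq_esum do rewrite EFinD.
by rewrite esumD ?lte_add_pinfty// => i _; rewrite lee_fin.
Qed.

Lemma nsumD D p q : (forall i, 0 <= p i) -> (forall i, 0 <= q i) ->
  has_nsum D p -> has_nsum D q -> nsum D (fun i => p i + q i) = nsum D p + nsum D q.
Proof.
move=> p0 q0 hp hq; apply: EFin_inj; rewrite EFinD.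
have h : has_nsum D (fun i => p i + q i) by exact: has_nsumD.
have h0 i : 0 <= p i + q i by rewrite addr_ge0.
by rewrite -!nsumE// -esumD// => i _; rewrite lee_fin.
Qed.

Lemma nsum_fin_le D p (s : seq T) : (forall i, 0 <= p i) -> has_nsum D p ->
  uniq s -> (forall i, i \in s -> D i) -> \sum_(i <- s) p i <= nsum D p.
Proof.
move=> p0 hp us sD; rewrite -lee_fin -nsumE// -sumEFin.
apply: esum_ge; exists [set` s].
  by split; [exact: finite_seq|move=> i /= /sD].
by rewrite fsbig_seq.
Qed.

Lemma esum_le_fin D p K :
  (forall s : seq T, uniq s -> (forall i, i \in s -> D i) -> \sum_(i <- s) p i <= K) ->
  (\esum_(i in D) (p i)%:E <= K%:E)%E.
Proof.
move=> h; apply: ge_ereal_sup => _ [X [fX XD] <-].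
rewrite fsbig_finite//= sumEFin lee_fin; apply: h => //.
by move=> i; rewrite in_fset_set// inE; exact: XD.
Qed.

Lemma has_nsumP D p K :
  (forall s : seq T, uniq s -> (forall i, i \in s -> D i) -> \sum_(i <- s) p i <= K) ->
  has_nsum D p.
Proof. by move=> h; apply: le_lt_trans (esum_le_fin h) _; rewrite ltry. Qed.

Lemma nsum_le D p K : (forall i, 0 <= p i) ->
  (forall s : seq T, uniq s -> (forall i, i \in s -> D i) -> \sum_(i <- s) p i <= K) ->
  nsum D p <= K.
Proof.
move=> p0 h; rewrite -lee_fin -nsumE//; first exact: esum_le_fin.
exact: has_nsumP h.
Qed.

Lemma nsumZ D p c : 0 <= c -> (forall i, 0 <= p i) -> has_nsum D p ->
  has_nsum D (fun i => c * p i) /\ nsum D (fun i => c * p i) = c * nsum D p.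
Proof.
(* Only the upper bound is proved directly, for all nonnegative scalars; using it with [c^-1] gives
   the reverse inequality. *)
move=> c0 p0 hp; have le (c' : R) q : 0 <= c' -> (forall i, 0 <= q i) -> has_nsum D q ->
    has_nsum D (fun i => c' * q i) /\ nsum D (fun i => c' * q i) <= c' * nsum D q.
  move=> c'0 q0 hq.
  have h s : uniq s -> (forall i, i \in s -> D i) ->
      \sum_(i <- s) c' * q i <= c' * nsum D q.
    by move=> us sD; rewrite -mulr_sumr ler_wpM2l// nsum_fin_le.
  by split; [exact: has_nsumP h|apply: nsum_le => // i; rewrite mulr_ge0].
have [h1 h2] := le _ _ c0 p0 hp; split => //.
apply/eqP; rewrite eq_le h2/=.
have [->|cn0] := eqVneq c 0.
  by rewrite mul0r nsum_ge0// => i; rewrite mul0r.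
have ci : 0 <= c^-1 by rewrite invr_ge0.
have cp0 i : 0 <= c * p i by rewrite mulr_ge0.
have [_] := le _ _ ci cp0 h1.
rewrite (_ : (fun i => c^-1 * (c * p i)) = p); last first.
  by apply/funext => i; rewrite mulKf.
by rewrite ler_pdivlMl// lt0r cn0.
Qed.

(** [sumR] is defined through positive and negative parts, which are not additive. Any other
    splitting into summable nonnegative functions gives the same value because
    [u^+ + q = p + u^-]. *)
Lemma sumR_diff D p q (u : T -> R) : (forall i, 0 <= p i) -> (forall i, 0 <= q i) ->
  has_nsum D p -> has_nsum D q -> (forall i, u i = p i - q i) ->
  sumR D u = nsum D p - nsum D q.
Proof.
move=> p0 q0 hp hq upq; rewrite /sumR.
rewrite -/(nsum D (fun i => Num.max (u i) 0)) -/(nsum D (fun i => Num.max (- u i) 0)).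
have m0 (v : T -> R) i : 0 <= Num.max (v i) 0 by rewrite le_max lexx orbT.
have h1 : has_nsum D (fun i => Num.max (u i) 0).
  by apply: le_has_nsum hp => i; rewrite ge_max p0 upq lerBlDr lerDl q0.
have h2 : has_nsum D (fun i => Num.max (- u i) 0).
  by apply: le_has_nsum hq => i; rewrite ge_max q0 upq opprB lerBlDr lerDl p0.
have m1 := m0 u; have m2 := m0 (fun i => - u i).
apply/eqP; rewrite subr_eq addrAC eq_sym subr_eq -!nsumD//.
apply/eqP; congr nsum; apply/funext => i.
rewrite upq opprB; have [?|?] := leP (p i - q i) 0; have [?|?] := leP (q i - p i) 0; lra.
Qed.

Definition abs_summable D f := has_nsum D (fun i => normc (f i)).

Lemma abs_summable_le D f p : (forall i, normc (f i) <= p i) -> has_nsum D p ->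
  abs_summable D f.
Proof. exact: le_has_nsum. Qed.

Lemma abs_summableD D f g : abs_summable D f -> abs_summable D g ->
  abs_summable D (fun i => f i + g i).
Proof.
move=> hf hg; apply: (@abs_summable_le D _ (fun i => normc (f i) + normc (g i))).
  by move=> i; exact: le_normcD.
by apply: has_nsumD => // i; exact: normc_ge0.
Qed.

Lemma abs_summableM D f g k : (forall i, normc (g i) <= k) -> abs_summable D f ->
  abs_summable D (fun i => g i * f i).
Proof.
move=> gk hf; apply: (@abs_summable_le D _ (fun i => `|k| * normc (f i))).
  move=> i; rewrite normcM ler_wpM2r ?normc_ge0//.
  by rewrite (le_trans (gk i))// ler_norm.
by apply: (nsumZ _ _ hf).1 => // i; exact: normc_ge0.
Qed.

Let has_re (F : C -> R) D f : (forall z, `|F z| <= normc z) -> abs_summable D f ->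
  has_nsum D (fun i => Num.max (F (f i)) 0) /\ has_nsum D (fun i => Num.max (- F (f i)) 0).
Proof.
move=> hF hf; split; apply: le_has_nsum hf => i; rewrite ge_max normc_ge0 andbT;
  apply: le_trans (hF _); first exact: ler_norm.
by rewrite -normrN ler_norm.
Qed.

Let max0 (x : R) : 0 <= Num.max x 0. Proof. by rewrite le_max lexx orbT. Qed.
Let maxE (x : R) : x = Num.max x 0 - Num.max (- x) 0.
Proof. have [?|?] := leP x 0; have [?|?] := leP (-x) 0; lra. Qed.

Let sumRD (F : C -> R) D f g : (forall z, `|F z| <= normc z) ->
  (forall x y, F (x + y) = F x + F y) -> abs_summable D f -> abs_summable D g ->
  sumR D (fun i => F (f i + g i)) = sumR D (fun i => F (f i)) + sumR D (fun i => F (g i)).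
Proof.
move=> hF FD hf hg; have [f1 f2] := has_re hF hf; have [g1 g2] := has_re hF hg.
have ff i := max0 (F (f i)); have fg i := max0 (F (g i)).
have nf i := max0 (- F (f i)); have ng i := max0 (- F (g i)).
rewrite (@sumR_diff D (fun i => Num.max (F (f i)) 0 + Num.max (F (g i)) 0)
   (fun i => Num.max (- F (f i)) 0 + Num.max (- F (g i)) 0)).
- by rewrite !nsumD// /sumR -!/(nsum _ _) opprD addrACA.
- by move=> i; rewrite addr_ge0.
- by move=> i; rewrite addr_ge0.
- exact: has_nsumD.
- exact: has_nsumD.
- by move=> i; rewrite FD {1}(maxE (F (f i))) {1}(maxE (F (g i))); ring.
Qed.

Lemma sumCD D f g : abs_summable D f -> abs_summable D g ->
  sumC D (fun i => f i + g i) = sumC D f + sumC D g.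
Proof.
move=> hf hg; rewrite /sumC.
rewrite (sumRD absRe_le _ hf hg); last by case=> ? ? [].
by rewrite (sumRD absIm_le _ hf hg)//; case=> ? ? [].
Qed.

Let sumRZ (r : R) D (u : T -> R) : has_nsum D (fun i => `|u i|) ->
  sumR D (fun i => r * u i) = r * sumR D u.
Proof.
move=> hu.
have h1 : has_nsum D (fun i => Num.max (u i) 0).
  by apply: le_has_nsum hu => i; rewrite ge_max ler_norm normr_ge0.
have h2 : has_nsum D (fun i => Num.max (- u i) 0).
  by apply: le_has_nsum hu => i; rewrite ge_max -{1}normrN ler_norm normr_ge0.
have uE := sumR_diff (fun i => max0 (u i)) (fun i => max0 (- u i)) h1 h2
  (fun i => maxE (u i)).
have [r0|r0] := leP 0 r.
  have [a1 b1] := nsumZ r0 (fun i => max0 (u i)) h1.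
  have [a2 b2] := nsumZ r0 (fun i => max0 (- u i)) h2.
  rewrite (sumR_diff _ _ a1 a2).
  - by rewrite b1 b2 -mulrBr uE.
  - by move=> i; rewrite mulr_ge0.
  - by move=> i; rewrite mulr_ge0.
  - by move=> i; rewrite -mulrBr -maxE.
have r0' : 0 <= - r by rewrite oppr_ge0 ltW.
have [a1 b1] := nsumZ r0' (fun i => max0 (u i)) h1.
have [a2 b2] := nsumZ r0' (fun i => max0 (- u i)) h2.
rewrite (sumR_diff _ _ a2 a1).
- by rewrite b1 b2 uE; ring.
- by move=> i; rewrite mulr_ge0.
- by move=> i; rewrite mulr_ge0.
- by move=> i; rewrite -mulrBr mulNr {1}(maxE (u i)); ring.
Qed.

Lemma sumCZ D c f : abs_summable D f ->
  sumC D (fun i => c * f i) = c * sumC D f.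
Proof.
move=> hf.
have hre : has_nsum D (fun i => `|complex.Re (f i)|).
  by apply: le_has_nsum hf => i; exact: absRe_le.
have him : has_nsum D (fun i => `|complex.Im (f i)|).
  by apply: le_has_nsum hf => i; exact: absIm_le.
have hc (r : R) : abs_summable D (fun i => (r * complex.Re (f i))%:C) /\
    abs_summable D (fun i => (r * complex.Im (f i))%:C).
  split; [apply: (@abs_summable_le D _ (fun i => `|r| * `|complex.Re (f i)|))|
    apply: (@abs_summable_le D _ (fun i => `|r| * `|complex.Im (f i)|))].
  - by move=> i; rewrite normcR normrM.
  - exact: (nsumZ _ _ hre).1.
  - by move=> i; rewrite normcR normrM.
  - exact: (nsumZ _ _ him).1.
rewrite /sumC; case: c => a b.
transitivity ((a * sumR D (fun i => complex.Re (f i)) - b * sumR D (fun i => complex.Im (f i)))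
   +i* (a * sumR D (fun i => complex.Im (f i)) + b * sumR D (fun i => complex.Re (f i)))); last by [].
congr (_ +i* _).
  rewrite -[- (b * _)]mulNr -!sumRZ//.
  rewrite -(sumRD absRe_le _ (hc a).1 (hc (- b)).2); last by case=> ? ? [].
  by congr sumR; apply/funext => i; case: (f i) => x y /=; rewrite mulNr.
rewrite -!sumRZ// -(sumRD absRe_le _ (hc a).2 (hc b).1); last by case=> ? ? [].
by congr sumR; apply/funext => i; case: (f i) => x y /=.
Qed.

(** Real and imaginary parts are summed separately, each sum being at most the sum of the moduli.
    This is the origin of the factor 2 in the bounds for [pair] and [conv]. *)
Lemma normc_sumC_le D f : abs_summable D f ->
  normc (sumC D f) <= 2 * nsum D (fun i => normc (f i)).
Proof.
move=> hf; have n0 i := normc_ge0 (f i).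
have key (F : C -> R) : (forall z, `|F z| <= normc z) ->
    `|sumR D (fun i => F (f i))| <= nsum D (fun i => normc (f i)).
  move=> hF; have [h1 h2] := has_re hF hf.
  rewrite /sumR -/(nsum D (fun i => Num.max (F (f i)) 0))
    -/(nsum D (fun i => Num.max (- F (f i)) 0)).
  have := nsum_ge0 D (fun i => max0 (F (f i))).
  have := nsum_ge0 D (fun i => max0 (- F (f i))).
  have : nsum D (fun i => Num.max (F (f i)) 0) <= nsum D (fun i => normc (f i)).
    apply: le_nsum => // i; rewrite ge_max normc_ge0 andbT.
    by apply: le_trans (hF _); exact: ler_norm.
  have : nsum D (fun i => Num.max (- F (f i)) 0) <= nsum D (fun i => normc (f i)).
    apply: le_nsum => // i; rewrite ge_max normc_ge0 andbT.
    by apply: le_trans (hF _); rewrite -normrN ler_norm.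
  by move=> *; rewrite ler_norml; lra.
apply: le_trans (normc_leReIm _) _.
by rewrite mulr2n mulrDl mul1r lerD ?key//; [exact: absRe_le|exact: absIm_le].
Qed.

Lemma sumC_ext D f g : (forall i, D i -> f i = g i) -> sumC D f = sumC D g.
Proof.
move=> fg; have e (F : C -> R) :
    sumR D (fun i => F (f i)) = sumR D (fun i => F (g i)).
  by congr (fine _ - fine _); apply: eq_esum => i Di; rewrite fg.
by rewrite /sumC !e.
Qed.

Lemma sumC0 D f : (forall i, D i -> f i = 0) -> sumC D f = 0.
Proof.
by move=> f0; rewrite (sumC_ext f0) /sumC /sumR !esum1//= ?subrr// => i _;
  rewrite /= ?oppr0 maxxx.
Qed.

Lemma sumC1 D f t : D t -> (forall i, D i -> i != t -> f i = 0) -> sumC D f = f t.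
Proof.
move=> Dt f0.
have e1 (u : T -> R) : (forall i, D i -> i != t -> u i = 0) -> sumR D u = u t.
  move=> u0; rewrite /sumR.
  have es (v : T -> R) : (forall i, 0 <= v i) -> (forall i, D i -> i != t -> v i = 0) ->
      (\esum_(i in D) (v i)%:E)%E = (v t)%:E.
    move=> vp v0; rewrite (esumID [set t])//; last by move=> *; rewrite lee_fin.
    rewrite [X in (_ + X)%E]esum1 ?adde0; last first.
      by move=> i [Di /eqP it]; rewrite v0.
    have -> : D `&` [set t] = [set t] by apply/setIidr => _ ->.
    by rewrite esum_set1// lee_fin.
  rewrite (es (fun i => Num.max (u i) 0))//; last first.
    by move=> i Di it; rewrite u0// maxxx.
  rewrite (es (fun i => Num.max (- u i) 0)) /= -?maxE//.
  by move=> i Di it; rewrite u0// oppr0 maxxx.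
rewrite /sumC !e1; first by case: (f t).
- by move=> i Di it; rewrite f0.
- by move=> i Di it; rewrite f0.
Qed.

End gen.
End Sums.

(** * The Banach space l^1(S) *)

Section EllOne.
Variables (R : realType) (S : choiceType).
Local Notation C := R[i].
Local Notation l1 := (@Defs.summable R S).
Local Notation l1norm := (@Defs.l1norm R S).
Local Notation pair := (@Defs.pair R S).
Local Notation delta := (@Defs.delta R S).
Implicit Types (a b x y f : S -> C).

Lemma l1D a b : l1 a -> l1 b -> l1 (fun g => a g + b g).
Proof. exact: abs_summableD. Qed.

Lemma l1Z c a : l1 a -> l1 (fun g => c * a g).
Proof. by move=> ha; apply: (abs_summableM (k := normc c)). Qed.

Lemma l1B a b : l1 a -> l1 b -> l1 (fun g => a g - b g).
Proof.
move=> ha hb; rewrite (_ : (fun g => _) = fun g => a g + (-1) * b g).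
  by apply: l1D => //; exact: l1Z.
by apply/funext => g; rewrite mulN1r.
Qed.

Lemma l1_0 : l1 (fun=> 0).
Proof.
apply: (has_nsumP (K := 0)) => s _ _; rewrite big1// => i _; exact: normc0.
Qed.

Lemma l1norm_ge0 a : 0 <= l1norm a.
Proof. by apply: nsum_ge0 => i; exact: normc_ge0. Qed.

Lemma l1normZ c a : l1 a -> l1norm (fun g => c * a g) = normc c * l1norm a.
Proof.
move=> ha; have n0 (z : C) := normc_ge0 z.
rewrite -(nsumZ (n0 c) (fun i => n0 (a i)) ha).2.
by congr nsum; apply/funext => i; rewrite normcM.
Qed.

Lemma l1norm_ub a g : l1 a -> normc (a g) <= l1norm a.
Proof.
move=> ha; have := nsum_fin_le (fun i => normc_ge0 (a i)) ha (s := [:: g]).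
by rewrite big_seq1; apply.
Qed.

Lemma delta_l1 g : l1 (delta g) /\ l1norm (delta g) = 1.
Proof.
have e : (\esum_(i in [set: S]) (normc (delta g i))%:E)%E = 1%E :> \bar R.
  rewrite (esumID [set g])//; last by move=> *; rewrite lee_fin normc_ge0.
  rewrite [X in (_ + X)%E]esum1 ?adde0; last first.
    by move=> i [_ /eqP it]; rewrite /delta (negbTE it) normc0.
  by rewrite setTI esum_set1 /delta ?eqxx ?normc1// lee_fin normc_ge0.
by split; rewrite /Defs.summable /Defs.l1norm e// ltry.
Qed.

Lemma delta_le1 g h : normc (delta g h) <= 1.
Proof. by rewrite /Defs.delta; case: ifP; rewrite ?normc1 ?normc0. Qed.

Section pairing.
Variables (f : S -> C) (k : R).
Hypothesis fk : forall g, normc (f g) <= k.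

Lemma pair_sum x : l1 x -> abs_summable setT (fun g => f g * x g).
Proof. exact: abs_summableM. Qed.

Lemma pairDr x y : l1 x -> l1 y -> pair f (fun g => x g + y g) = pair f x + pair f y.
Proof.
move=> hx hy; rewrite -sumCD; try exact: pair_sum.
by apply: sumC_ext => i _; rewrite mulrDr.
Qed.

Lemma pairZr c x : l1 x -> pair f (fun g => c * x g) = c * pair f x.
Proof.
move=> hx; rewrite -sumCZ; last exact: pair_sum.
by apply: sumC_ext => i _; rewrite mulrCA.
Qed.

Lemma pair_delta g : pair f (delta g) = f g.
Proof.
rewrite /Defs.pair (@sumC1 _ _ _ _ g)//.
  by rewrite /Defs.delta eqxx mulr1.
by move=> i _ /negbTE ig; rewrite /Defs.delta ig mulr0.
Qed.

Lemma pair_le x : l1 x -> normc (pair f x) <= 2 * (k * l1norm x).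
Proof.
move=> hx; apply: le_trans (normc_sumC_le (pair_sum hx)) _.
rewrite ler_pM2l//.
(* When [S] has no point, [k] may be negative; both sides are then empty sums. *)
have [[g]|noS] := pselect (inhabited S); last first.
  rewrite /nsum /Defs.l1norm; have -> : [set: S] = set0.
    by apply/seteqP; split=> // g; case: noS; exists.
  by rewrite !esum_set0 mulr0.
have k0 : 0 <= k by apply: le_trans (fk g); exact: normc_ge0.
rewrite -(nsumZ k0 (fun i => normc_ge0 (x i)) hx).2.
apply: le_nsum => [i|i|]; first exact: normc_ge0.
  by rewrite normcM ler_wpM2r ?normc_ge0.
by apply: (nsumZ _ _ hx).1 => // i; exact: normc_ge0.
Qed.

End pairing.

Lemma pairDl f (f' : S -> C) x : Defs.bounded f -> Defs.bounded f' -> l1 x ->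
  pair (fun h => f h + f' h) x = pair f x + pair f' x.
Proof.
move=> [k fk] [k' gk] hx.
rewrite -sumCD; [|exact: (pair_sum fk hx)|exact: (pair_sum gk hx)].
by apply: sumC_ext => i _; rewrite mulrDl.
Qed.

Lemma pairZl c f x : Defs.bounded f -> l1 x -> pair (fun h => c * f h) x = c * pair f x.
Proof.
move=> [k fk] hx; rewrite -sumCZ; last exact: (pair_sum fk hx).
by apply: sumC_ext => i _; rewrite mulrA.
Qed.

Lemma l1_finite_approx a e : l1 a -> 0 < e ->
  exists s : seq S, uniq s /\
    l1norm (fun g => a g - (if g \in s then a g else 0)) <= e.
Proof.
move=> ha e0; have n0 i := normc_ge0 (a i).
have [s us hs] : exists2 s : seq S, uniq s & l1norm a - e < \sum_(i <- s) normc (a i).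
  apply: contrapT => hn.
  suff : l1norm a <= l1norm a - e by rewrite leNgt ltrBlDr ltrDl e0.
  apply: nsum_le => // s us _; rewrite leNgt; apply/negP => hs.
  by apply: hn; exists s.
exists s; split => //; apply: nsum_le => [i|t ut _]; first exact: normc_ge0.
pose t' := [seq g <- t | g \notin s].
have : \sum_(i <- s ++ t') normc (a i) <= l1norm a.
  apply: nsum_fin_le => //; rewrite cat_uniq us filter_uniq// andbT.
  by apply/hasPn => i; rewrite mem_filter => /andP[].
rewrite big_cat/= => h.
rewrite (_ : \sum_(i <- t) _ = \sum_(i <- t') normc (a i)); first lra.
rewrite big_filter [RHS]big_mkcond/=; apply: eq_bigr => i _.
by case: ifPn; rewrite /= ?subrr ?normc0 ?subr0.
Qed.

(** Finitely supported functions are norm-dense, so a property stable under linear combinations and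
    norm limits need only be checked on unit vectors. *)
Lemma l1_ind (P : (S -> C) -> Prop) :
  P (fun=> 0) ->
  (forall a b, l1 a -> l1 b -> P a -> P b -> P (fun g => a g + b g)) ->
  (forall c a, l1 a -> P a -> P (fun g => c * a g)) ->
  (forall g, P (delta g)) ->
  (forall a, l1 a -> (forall e, 0 < e -> exists b, [/\ l1 b, P b &
     l1norm (fun g => a g - b g) <= e]) -> P a) ->
  forall a, l1 a -> P a.
Proof.
move=> P0 PD PZ Pd Pl a ha; apply: Pl => // e e0.
have [s [us hs]] := l1_finite_approx ha e0.
exists (fun g => if g \in s then a g else 0).
suff [? ?] : l1 (fun g => if g \in s then a g else 0) /\ P (fun g => if g \in s then a g else 0).
  by split.
elim: s us {hs} => [_|h s IH /= /andP[hs us]]; first by split => //; exact: l1_0.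
have {IH us} [l1s Ps] := IH us.
have [l1h _] := delta_l1 h.
rewrite (_ : (fun g => _) = fun g => a h * delta h g + (if g \in s then a g else 0)).
  by split; [apply: l1D => //; exact: l1Z|apply: PD => //; [exact: l1Z|exact: PZ]].
apply/funext => g; rewrite inE /Defs.delta.
by have [->|_] := eqVneq g h; rewrite ?(negbTE hs) ?mulr1 ?addr0// mulr0 add0r.
Qed.

(** A bounded functional on [l^1] is carried by a function on all of [S -> C], whose values off
    [l^1] are left arbitrary. *)
Definition l1lin (F : (S -> C) -> C) : Prop :=
  [/\ (forall a b, l1 a -> l1 b -> F (fun g => a g + b g) = F a + F b),
      (forall c a, l1 a -> F (fun g => c * a g) = c * F a)
    & exists k, forall a, l1 a -> normc (F a) <= k * l1norm a].

Lemma l1lin0 F : l1lin F -> F (fun=> 0) = 0.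
Proof.
move=> [_ h _]; have := h 0 (fun=> 0) l1_0.
by rewrite !mul0r.
Qed.

Lemma l1linD F G : l1lin F -> l1lin G -> l1lin (fun a => F a + G a).
Proof.
move=> [F1 F2 [k F3]] [G1 G2 [k' G3]]; split.
- by move=> a b ha hb; rewrite F1// G1// addrACA.
- by move=> c a ha; rewrite F2// G2// mulrDr.
- exists (k + k') => a ha; apply: le_trans (le_normcD _ _) _.
  by rewrite mulrDl lerD ?F3 ?G3.
Qed.

Lemma l1linZ c F : l1lin F -> l1lin (fun a => c * F a).
Proof.
move=> [F1 F2 [k F3]]; split.
- by move=> a b ha hb; rewrite F1// mulrDr.
- by move=> c' a ha; rewrite F2// mulrCA.
- exists (normc c * k) => a ha; rewrite normcM -mulrA ler_wpM2l ?normc_ge0//.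
  exact: F3.
Qed.

Lemma l1linB F G : l1lin F -> l1lin G -> l1lin (fun a => F a - G a).
Proof.
move=> hF hG; rewrite (_ : (fun a => _) = fun a => F a + (-1) * G a).
  by apply: l1linD => //; exact: l1linZ.
by apply/funext => a; rewrite mulN1r.
Qed.

Lemma l1lin_pair f : Defs.bounded f -> l1lin (pair f).
Proof.
move=> [k fk]; split.
- by move=> a b ha hb; exact: (pairDr fk).
- by move=> c a ha; exact: (pairZr fk).
- by exists (2 * k) => a ha; rewrite -mulrA; exact: pair_le.
Qed.

Lemma l1lin_eq0 F : l1lin F -> (forall g, F (delta g) = 0) -> forall a, l1 a -> F a = 0.
Proof.
move=> hF Fd; have F0 := l1lin0 hF; case: hF => F1 F2 [k Fk].
apply: l1_ind => //.
- by move=> a b ha hb ea eb; rewrite F1// ea eb addr0.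
- by move=> c a ha ea; rewrite F2// ea mulr0.
move=> a ha h; apply/eq0_normc/eqP; rewrite eq_le normc_ge0 andbT.
apply/ler_addgt0Pl => e e0; rewrite addr0.
have k1 : 0 < `|k| + 1 by rewrite ltr_wpDl.
have [b [hb Fb hab]] := h (e / (`|k| + 1)) (divr_gt0 e0 k1).
have -> : F a = F (fun g => (a g - b g) + b g) by congr F; apply/funext => g; rewrite subrK.
rewrite F1//; last exact: l1B.
rewrite Fb addr0; apply: le_trans (Fk _ (l1B ha hb)) _.
apply: (@le_trans _ _ ((`|k| + 1) * (e / (`|k| + 1)))); last first.
  by rewrite mulrC divfK// gt_eqF.
apply: (@le_trans _ _ ((`|k| + 1) * l1norm (fun g => a g - b g))).
  by rewrite ler_wpM2r ?l1norm_ge0// ler_wpDr// ler_norm.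
by rewrite ler_wpM2l// ltW.
Qed.

Lemma l1lin_ext F G : l1lin F -> l1lin G -> (forall g, F (delta g) = G (delta g)) ->
  forall a, l1 a -> F a = G a.
Proof.
move=> hF hG FG a ha; apply/eqP; rewrite -subr_eq0; apply/eqP.
apply: (l1lin_eq0 (l1linB hF hG)) => // g; by rewrite FG subrr.
Qed.

(** This is [(l^1)' = l^infty]. It turns orbit maps into pairings, so that weak* continuity becomes
    a [c_0] condition on the values at unit vectors. *)
Lemma l1lin_pairE F : l1lin F -> forall a, l1 a -> F a = pair (fun g => F (delta g)) a.
Proof.
move=> hF; case: (hF) => _ _ [k Fk].
have bF : Defs.bounded (fun g => F (delta g)).
  by exists k => g; have [l1g n1] := delta_l1 g; have := Fk _ l1g; rewrite n1 mulr1.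
apply: l1lin_ext => //; first exact: l1lin_pair.
by move=> g; rewrite pair_delta.
Qed.

End EllOne.

(** * Weighted convolution on [l^1(S)] *)

Section Convolution.
Variables (R : realType) (S : choiceType) (op : S -> S -> S) (w : S -> R).
Hypothesis w_gt0 : forall s, 0 < w s.
Hypothesis w_sub : forall s t, w (op s t) <= w s * w t.
Local Notation C := R[i].
Local Notation l1 := (@Defs.summable R S).
Local Notation l1norm := (@Defs.l1norm R S).
Local Notation delta := (@Defs.delta R S).
Local Notation conv := (Defs.conv op w).
Local Notation Om := (Defs.Omega op w).
Implicit Types a b : S -> C.

Lemma Omega_gt0 g h : 0 < Om g h.
Proof. by rewrite divr_gt0// mulr_gt0. Qed.

Lemma Omega_le1 g h : Om g h <= 1.
Proof. by rewrite ler_pdivrMr ?mulr_gt0// mul1r. Qed.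

Lemma normc_Omega_le g h (z : C) : normc ((Om g h)%:C * z) <= normc z.
Proof.
rewrite normcM normcR ger0_norm ?(ltW (Omega_gt0 _ _))//.
by rewrite -[leRHS]mul1r ler_wpM2r ?normc_ge0// Omega_le1.
Qed.

(** Both sides equal [w(ghj) / (w g * w h * w j)], the coefficient of either bracketing of a triple
    product of unit vectors. *)
Lemma Omega_cocycle g h j : associative op ->
  Om g (op h j) * Om h j = Om (op g h) j * Om g h.
Proof.
move=> opA; rewrite /Defs.Omega opA.
have n0 s : w s != 0 by rewrite gt_eqF.
field.
by rewrite !n0.
Qed.

Let fibre k := [set p : S * S | op p.1 p.2 = k].
Let prodn a b (p : S * S) := normc (a p.1) * normc (b p.2).

Let prodn_ge0 a b p : 0 <= prodn a b p.
Proof. by rewrite mulr_ge0 ?normc_ge0. Qed.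

Let prodn_sum a b : l1 a -> l1 b ->
  (\esum_(p in [set: S * S]) (prodn a b p)%:E)%E = (l1norm a * l1norm b)%:E.
Proof.
move=> ha hb.
have -> : [set: S * S] = setT `*`` (fun=> setT) by apply/seteqP; split.
rewrite -(esum_esum (a := fun i j => (normc (a i) * normc (b j))%:E)); last first.
  by move=> *; rewrite lee_fin mulr_ge0 ?normc_ge0.
have eb g : (\esum_(j in [set: S]) (normc (a g) * normc (b j))%:E)%E =
    (l1norm b * normc (a g))%:E.
  have [h1 h2] := nsumZ (normc_ge0 (a g)) (fun i => normc_ge0 (b i)) hb.
  rewrite nsumE//; first by rewrite h2 mulrC.
  by move=> i; rewrite mulr_ge0 ?normc_ge0.
under eq_esum do rewrite eb.
have [h1 h2] := nsumZ (l1norm_ge0 b) (fun i => normc_ge0 (a i)) ha.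
rewrite nsumE//; first by rewrite h2 mulrC.
by move=> i; rewrite mulr_ge0 ?normc_ge0 ?l1norm_ge0.
Qed.

Let fibre_prodn a b k : l1 a -> l1 b -> has_nsum (fibre k) (prodn a b).
Proof.
move=> ha hb; apply: (@has_nsumP _ _ _ _ (l1norm a * l1norm b)) => s us _.
rewrite -lee_fin -prodn_sum//; rewrite -sumEFin; apply: esum_ge.
by exists [set` s]; [split; [exact: finite_seq|]|rewrite fsbig_seq].
Qed.

Let conv_term a b (p : S * S) := (Om p.1 p.2)%:C * a p.1 * b p.2.

Let conv_sum a b k : l1 a -> l1 b -> abs_summable (fibre k) (conv_term a b).
Proof.
move=> ha hb; apply: abs_summable_le (fibre_prodn k ha hb) => p.
by rewrite /conv_term -mulrA /prodn -normcM normc_Omega_le.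
Qed.

(** The fibres of [op] partition [S * S], hence the fibre sums add up to the full double sum. *)
Let esum_fibres a b : l1 a -> l1 b ->
  (\esum_(k in [set: S]) (nsum (fibre k) (prodn a b))%:E)%E = (l1norm a * l1norm b)%:E.
Proof.
move=> ha hb; rewrite -prodn_sum//.
under eq_esum do rewrite -(nsumE (prodn_ge0 a b) (fibre_prodn _ ha hb)).
rewrite (esum_esum (a := fun _ p => (prodn a b p)%:E)); last first.
  by move=> *; rewrite lee_fin.
rewrite (reindex_esum setT _ (fun p => (op p.1 p.2, p)))//; split=> //=.
- by move=> p q _ _ [].
- by move=> [k p] /= [_ <-]; exists p.
Qed.

Lemma conv_l1_norm a b : l1 a -> l1 b ->
  l1 (conv a b) /\ l1norm (conv a b) <= 2 * (l1norm a * l1norm b).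
Proof.
move=> ha hb; have fE := esum_fibres ha hb.
have h : has_nsum setT (fun k => nsum (fibre k) (prodn a b)).
  by rewrite /has_nsum fE ltry.
have h0 k : 0 <= nsum (fibre k) (prodn a b) by exact: nsum_ge0.
have [h1 h2] := nsumZ (ler0n R 2) h0 h.
have le k : normc (conv a b k) <= 2 * nsum (fibre k) (prodn a b).
  apply: le_trans (normc_sumC_le (conv_sum k ha hb)) _.
  rewrite ler_pM2l//; apply: le_nsum => [p|p|]; first exact: normc_ge0.
    by rewrite /conv_term -mulrA /prodn -normcM normc_Omega_le.
  exact: fibre_prodn.
split; first exact: le_has_nsum le h1.
have -> : l1norm a * l1norm b = nsum setT (fun k => nsum (fibre k) (prodn a b)).
  by rewrite /nsum fE.
rewrite -h2; apply: le_nsum => // k; exact: normc_ge0.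
Qed.

Lemma conv_l1 a b : l1 a -> l1 b -> l1 (conv a b).
Proof. by move=> ha hb; case: (conv_l1_norm ha hb). Qed.

Lemma convDl a a' b : l1 a -> l1 a' -> l1 b ->
  conv (fun g => a g + a' g) b = fun k => conv a b k + conv a' b k.
Proof.
move=> ha ha' hb; apply/funext => k.
rewrite -(sumCD (conv_sum k ha hb) (conv_sum k ha' hb)).
by apply: sumC_ext => p _; rewrite /conv_term mulrDr mulrDl.
Qed.

Lemma convDr a b b' : l1 a -> l1 b -> l1 b' ->
  conv a (fun g => b g + b' g) = fun k => conv a b k + conv a b' k.
Proof.
move=> ha hb hb'; apply/funext => k.
rewrite -(sumCD (conv_sum k ha hb) (conv_sum k ha hb')).
by apply: sumC_ext => p _; rewrite /conv_term mulrDr.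
Qed.

Lemma convZl c a b : l1 a -> l1 b ->
  conv (fun g => c * a g) b = fun k => c * conv a b k.
Proof.
move=> ha hb; apply/funext => k; rewrite -(sumCZ c (conv_sum k ha hb)).
by apply: sumC_ext => p _; rewrite /conv_term; ring.
Qed.

Lemma convZr c a b : l1 a -> l1 b ->
  conv a (fun g => c * b g) = fun k => c * conv a b k.
Proof.
move=> ha hb; apply/funext => k; rewrite -(sumCZ c (conv_sum k ha hb)).
by apply: sumC_ext => p _; rewrite /conv_term; ring.
Qed.

Lemma conv_delta g h :
  conv (delta g) (delta h) = fun k => (Om g h)%:C * delta (op g h) k.
Proof.
apply/funext => k; rewrite /Defs.conv /Defs.delta.
have [->|kgh] := eqVneq k (op g h).
  rewrite (@sumC1 _ _ _ _ (g, h))//=; first by rewrite !eqxx !mulr1.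
  move=> [g' h'] /= _; rewrite xpair_eqE negb_and.
  by case/orP => /negbTE ->; rewrite ?mulr0 ?mul0r.
rewrite mulr0 sumC0// => -[g' h'] /= e.
have [eg|_] := eqVneq g' g; last by rewrite mulr0 mul0r.
have [eh|_] := eqVneq h' h; last by rewrite mulr0.
by move: kgh; rewrite -e eg eh eqxx.
Qed.

Lemma l1lin_convl F b : l1lin F -> l1 b -> l1lin (fun a => F (conv a b)).
Proof.
move=> [F1 F2 [k F3]] hb; split.
- by move=> a a' ha ha'; rewrite convDl// F1//; exact: conv_l1.
- by move=> c a ha; rewrite convZl// F2//; exact: conv_l1.
- exists (`|k| * (2 * l1norm b)) => a ha.
  have [h1 h2] := conv_l1_norm ha hb.
  apply: le_trans (F3 _ h1) _.
  apply: (@le_trans _ _ (`|k| * l1norm (conv a b))).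
    by rewrite ler_wpM2r ?l1norm_ge0// ler_norm.
  by rewrite -mulrA ler_wpM2l// -mulrA [l1norm b * _]mulrC.
Qed.

Lemma l1lin_convr F a : l1lin F -> l1 a -> l1lin (fun b => F (conv a b)).
Proof.
move=> [F1 F2 [k F3]] ha; split.
- by move=> b b' hb hb'; rewrite convDr// F1//; exact: conv_l1.
- by move=> c b hb; rewrite convZr// F2//; exact: conv_l1.
- exists (`|k| * (2 * l1norm a)) => b hb.
  have [h1 h2] := conv_l1_norm ha hb.
  apply: le_trans (F3 _ h1) _.
  apply: (@le_trans _ _ (`|k| * l1norm (conv a b))).
    by rewrite ler_wpM2r ?l1norm_ge0// ler_norm.
  by rewrite -mulrA ler_wpM2l// -mulrA.
Qed.

(** Density is applied in one variable at a time. The module laws and the Leibniz rule below are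
    reduced in this way to unit vectors. *)
Lemma l1bilin_ext (F G : (S -> C) -> (S -> C) -> C) :
  (forall a, l1 a -> l1lin (F a)) -> (forall b, l1 b -> l1lin (F^~ b)) ->
  (forall a, l1 a -> l1lin (G a)) -> (forall b, l1 b -> l1lin (G^~ b)) ->
  (forall g h, F (delta g) (delta h) = G (delta g) (delta h)) ->
  forall a b, l1 a -> l1 b -> F a b = G a b.
Proof.
move=> F1 F2 G1 G2 FG a b ha hb.
apply: (l1lin_ext (F1 a ha) (G1 a ha)) => // h.
have [hd _] := delta_l1 R h.
by apply: (l1lin_ext (F2 _ hd) (G2 _ hd)).
Qed.

End Convolution.

(** * Bounded functions vanishing at infinity along fibres *)

Section FibreVanishing.
Variables (R : realType) (T : Type) (K : choiceType) (pi : T -> K).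
Local Notation C := R[i].
Implicit Types f : T -> C.

(** The norm closure of the bounded functions supported on finitely many fibres. No decay is asked
    inside a fibre, so every bounded function on a single fibre belongs. *)
Definition fibre_c0 (f : T -> C) : Prop :=
  (exists k : R, forall t, normc (f t) <= k) /\
  forall e : R, 0 < e -> finite_set [set j | exists2 t, pi t = j & e <= normc (f t)].

Definition fibre_c0_pred : {pred T -> C} := fun f => `[< fibre_c0 f >].

Lemma fibre_c0_submod_closed : submod_closed fibre_c0_pred.
Proof.
split.
  have z t : normc ((0 : T -> C) t) <= 0 by rewrite [X in X <= _]normc0.
  apply/asboolP; split; first by exists 0 => t; exact: z.
  move=> e e0; rewrite (_ : [set _ | _] = set0)//; apply/seteqP; split=> //.
  by move=> j /= [t _] h; have := le_trans h (z t); rewrite leNgt e0.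
move=> c f g /asboolP[[kf fk] f0] /asboolP[[kg gk] g0]; apply/asboolP; split.
  exists (normc c * kf + kg) => t; apply: le_trans (le_normcD _ _) _.
  by rewrite normcM lerD// ler_wpM2l ?normc_ge0.
move=> e e0; pose d := e / 2 / (normc c + 1).
have c1 : 0 < normc c + 1 by rewrite ltr_wpDl ?normc_ge0.
have d0 : 0 < d by rewrite !divr_gt0.
have e2 : 0 < e / 2 by rewrite divr_gt0.
apply: sub_finite_set (_ : finite_set ([set j | exists2 t, pi t = j & d <= normc (f t)] `|`
   [set j | exists2 t, pi t = j & e / 2 <= normc (g t)])); last first.
  by rewrite finite_setU; split; [exact: f0|exact: g0].
move=> j /= [t tj et]; have [h|h] := leP d (normc (f t)); first by left; exists t.
right; exists t => //; rewrite leNgt; apply/negP => h'.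
move: et; rewrite leNgt => /negP; apply.
apply: le_lt_trans (le_normcD _ _) _; rewrite normcM.
rewrite [ltRHS](splitr e); apply: ler_ltD => //.
apply: (@le_trans _ _ ((normc c + 1) * d)); last by rewrite /d mulrC divfK// gt_eqF.
by apply: ler_pM => //; [exact: normc_ge0|exact: normc_ge0|rewrite lerDl|exact: ltW].
Qed.

HB.instance Definition _ := GRing.isSubmodClosed.Build C (T -> C) fibre_c0_pred
  fibre_c0_submod_closed.

Record c0fun := C0fun { c0fun_val :> T -> C; _ : c0fun_val \in fibre_c0_pred }.

HB.instance Definition _ := [isSub for c0fun_val].
HB.instance Definition _ := [Choice of c0fun by <:].
HB.instance Definition _ := [SubChoice_isSubLmodule of c0fun by <:].

Implicit Types x y : c0fun.

Lemma c0fun_P x : fibre_c0 x.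
Proof. by case: x => f /= /asboolP. Qed.

Lemma c0fun_ext x y : (forall t, x t = y t) -> x = y.
Proof. by move=> xy; apply/val_inj/funext. Qed.

Lemma c0fun_D x y t : (x + y) t = x t + y t. Proof. by []. Qed.
Lemma c0fun_Z c x t : (c *: x) t = c * x t. Proof. by []. Qed.

Definition supn (f : T -> C) : R := sup [set normc (f t) | t in setT].

Lemma supn_ub f k t : (forall t, normc (f t) <= k) -> normc (f t) <= supn f.
Proof.
move=> fk; apply: ub_le_sup; last by exists t.
by exists k => _ [t' _ <-].
Qed.

Lemma supn_ge0 f : 0 <= supn f.
Proof.
(* An empty or unbounded set has [sup] equal to 0 by convention. *)
rewrite /supn; have [h|h] := pselect (has_sup [set normc (f t) | t in setT]).
  have [[y [t _ _]] hu] := h.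
  by apply: le_trans (normc_ge0 (f t)) _; apply: ub_le_sup => //; exists t.
by rewrite sup_out.
Qed.

Lemma supn_le f k : 0 <= k -> (forall t, normc (f t) <= k) -> supn f <= k.
Proof.
move=> k0 fk; have [[t]|h] := pselect (inhabited T).
  by apply: ge_sup; [exists (normc (f t)); exists t|move=> _ [t' _ <-]].
rewrite /supn (_ : [set _ | _ in _] = set0) ?sup0//.
by apply/seteqP; split=> // y [t _ _]; case: h; constructor.
Qed.

Definition c0fun_norm x : C := (supn x)%:C.

Lemma c0fun_le x t : normc (x t) <= supn x.
Proof. by have [[k xk] _] := c0fun_P x; exact: supn_ub xk. Qed.

Lemma c0fun_normD x y : c0fun_norm (x + y) <= c0fun_norm x + c0fun_norm y.
Proof.
rewrite /c0fun_norm -rmorphD lecR; apply: supn_le; first by rewrite addr_ge0 ?supn_ge0.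
move=> t; rewrite c0fun_D; apply: le_trans (le_normcD _ _) _.
by rewrite lerD// c0fun_le.
Qed.

Lemma c0fun_normZ (c : C) x : c0fun_norm (c *: x) = `|c| * c0fun_norm x.
Proof.
rewrite /c0fun_norm normC_E -rmorphM; congr (_%:C).
have le (d : C) (y : c0fun) : supn (d *: y) <= normc d * supn y.
  apply: supn_le => [|t]; first by rewrite mulr_ge0 ?normc_ge0 ?supn_ge0.
  by rewrite c0fun_Z normcM ler_wpM2l ?normc_ge0// c0fun_le.
apply/eqP; rewrite eq_le le/=.
have [->|c0] := eqVneq c 0; first by rewrite normc0 mul0r supn_ge0.
have nc : 0 < normc c.
  by rewrite lt0r normc_ge0 andbT; apply: contra_neq c0 => /eq0_normc.
have := le c^-1 (c *: x); rewrite scalerA mulVf// scale1r normcV.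
by rewrite ler_pdivlMl.
Qed.

Lemma c0fun_norm_eq0 x : c0fun_norm x = 0 -> x = 0.
Proof.
move=> /(congr1 (@complex.Re R)) h; have {}h : supn x = 0 := h.
apply/val_inj/funext => t; apply/eq0_normc/eqP.
by rewrite eq_le normc_ge0 andbT -h c0fun_le.
Qed.

HB.instance Definition _ := Lmodule_isNormed.Build C c0fun
  c0fun_normD c0fun_normZ c0fun_norm_eq0.

Lemma c0fun_normE x : `|x| = (supn x)%:C.
Proof. by []. Qed.

(** Real and imaginary parts converge pointwise by completeness of [R]; the Cauchy condition makes
    the convergence uniform, and vanishing along fibres passes to uniform limits. *)
Lemma c0fun_complete (F : set_system c0fun) : ProperFilter F -> cauchy F -> cvg F.
Proof.
move=> FF /cauchyP Fc.
have Fc1 (e : R) : 0 < e -> exists x, F [set y | supn (x - y) <= e].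
  move=> e0; have eC : (0 : C) < e%:C by rewrite ltcR.
  have [x Fx] := Fc _ eC; exists x; apply: filterS Fx => y.
  by rewrite -ball_normE /= c0fun_normE ltcR => /ltW.
have cvgF (G : C -> R) : (forall z z' : C, `|G z - G z'| <= normc (z - z')) -> forall t,
    exists l : R, forall e, 0 < e -> F [set y | `|l - G (y t)| <= e].
  move=> hG t; pose Gt (y : c0fun) := G (y t).
  have : cvg (Gt @ F).
    apply: R_complete; apply/cauchyP => e e0.
    have e20 : 0 < e / 2 by rewrite divr_gt0.
    have [x Fx] := Fc1 _ e20; exists (Gt x); rewrite /fmap/= nbhs_simpl/=.
    apply: filterS Fx => y /= xy; rewrite -ball_normE /=.
    apply: le_lt_trans (hG _ _) _; apply: (@le_lt_trans _ _ (e / 2)); last first.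
      by rewrite ltr_pdivrMr// ltr_pMr// ltr1n.
    by apply: le_trans xy; exact: (c0fun_le (x - y)).
  move=> /cvg_ex[l /cvgrPdist_le hl]; exists l => e e0.
  exact: hl.
have hRe (z z' : C) : `|complex.Re z - complex.Re z'| <= normc (z - z').
  by have := absRe_le (z - z'); case: z => ? ?; case: z'.
have hIm (z z' : C) : `|complex.Im z - complex.Im z'| <= normc (z - z').
  by have := absIm_le (z - z'); case: z => ? ?; case: z'.
have [re hre] := choice (cvgF _ hRe).
have [im him] := choice (cvgF _ hIm).
have [l l_lim] : exists l : T -> C, forall t e, 0 < e -> F [set y | normc (l t - y t) <= e].
  exists (fun t => re t +i* im t) => t e e0; have e20 : 0 < e / 2 by rewrite divr_gt0.
  apply: filterS2 (hre t _ e20) (him t _ e20) => y /= h1 h2.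
  apply: le_trans (normc_leReIm _) _; rewrite [leRHS]splitr lerD//.
    by move: h1; case: (y t).
  by move: h2; case: (y t).
have l_unif e : 0 < e -> exists x, F [set y | supn (x - y) <= e] /\
    forall t, normc (l t - x t) <= e.
  move=> e0; have [x Fx] := Fc1 _ e0; exists x; split => // t.
  apply/ler_addgt0Pl => d d0.
  have [y [/= h1 h2]] := @filter_ex _ F FF _ (@filterI _ F _ _ _ Fx (l_lim t _ d0)).
  rewrite (_ : l t - x t = (l t - y t) + - ((x - y) t)); last first.
    by rewrite [(x - y) t](_ : _ = x t - y t)// opprB addrA subrK.
  apply: le_trans (le_normcD _ _) _; rewrite lerD//.
  by rewrite normcN; apply: le_trans h1; exact: c0fun_le.
have lc0 : l \in fibre_c0_pred.
  apply/asboolP; split.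
    have [x [_ hx]] := l_unif 1 ltr01; exists (1 + supn x) => t.
    rewrite -[l t](subrK (x t)); apply: le_trans (le_normcD _ _) _.
    by rewrite lerD// c0fun_le.
  move=> e e0; have e20 : 0 < e / 2 by rewrite divr_gt0.
  have [x [_ hx]] := l_unif _ e20; have [_ /(_ _ e20) fin] := c0fun_P x.
  apply: sub_finite_set fin => j /= [t tj et]; exists t => //.
  rewrite -(lerD2l (e / 2)) -splitr; apply: le_trans et _.
  rewrite -[l t](subrK (x t)); apply: le_trans (le_normcD _ _) _.
  by rewrite lerD.
apply/cvg_ex; exists (C0fun lc0); apply/cvgrPdist_le => e e0.
(* The radius [e] is a complex number; being positive, it is real. *)
have [d d0 de] : exists2 d : R, 0 < d & (d + d)%:C <= e.
  exists (complex.Re e / 2).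
    by rewrite divr_gt0//; move: e0; rewrite ltcE => /andP[_].
  by rewrite -splitr RRe_real// gtr0_real.
have [x [Fx hx]] := l_unif _ d0; apply: filterS Fx => y /= xy.
apply: le_trans de; rewrite c0fun_normE lecR; apply: supn_le.
  by rewrite addr_ge0 ?ltW.
move=> t; rewrite [X in normc X](_ : _ = (l t - x t) + (x - y) t); last first.
  by rewrite [(x - y) t](_ : _ = x t - y t)// addrA subrK.
apply: le_trans (le_normcD _ _) _; rewrite lerD//.
by apply: le_trans xy; exact: c0fun_le.
Qed.

HB.instance Definition _ := Uniform_isComplete.Build c0fun c0fun_complete.

Record c0_model (E : completeNormedModType C) (ev : E -> T -> C) : Prop := C0Model {
  c0_modelP : forall x : E, fibre_c0 (ev x);
  c0_model_ext : forall x y : E, (forall t, ev x t = ev y t) -> x = y;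
  c0_modelD : forall (x y : E) t, ev (x + y) t = ev x t + ev y t;
  c0_modelZ : forall c (x : E) t, ev (c *: x) t = c * ev x t;
  c0_model_norm : forall x : E, `|x| = (supn (ev x))%:C;
  c0_model_surj : forall f, fibre_c0 f -> exists x : E, forall t, ev x t = f t }.

(* Sealed: unfolding the concrete structures makes failing unifications explode. *)
Lemma c0_space : {E : completeNormedModType C & {ev : E -> T -> C | c0_model ev}}.
Proof.
exists c0fun, c0fun_val; split.
- exact: c0fun_P.
- exact: c0fun_ext.
- exact: c0fun_D.
- exact: c0fun_Z.
- exact: c0fun_normE.
- move=> f f0; have fP : f \in fibre_c0_pred by apply/asboolP.
  by exists (C0fun fP).
Qed.

Definition fibreC0 : completeNormedModType C := projT1 c0_space.

Definition ev : fibreC0 -> T -> C := sval (projT2 c0_space).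

Let fc_model : c0_model ev := svalP (projT2 c0_space).

Implicit Types u v : fibreC0.

Lemma fcP u : fibre_c0 (ev u).
Proof. exact: c0_modelP fc_model u. Qed.

Lemma fc_ext u v : (forall t, ev u t = ev v t) -> u = v.
Proof. exact: c0_model_ext fc_model u v. Qed.

Lemma fcD u v t : ev (u + v) t = ev u t + ev v t.
Proof. exact: c0_modelD fc_model u v t. Qed.

Lemma fcZ c u t : ev (c *: u) t = c * ev u t.
Proof. exact: c0_modelZ fc_model c u t. Qed.

Lemma fc0 t : ev 0 t = 0.
Proof. by rewrite -(scale0r 0) fcZ mul0r. Qed.

Lemma fcB u v t : ev (u - v) t = ev u t - ev v t.
Proof. by rewrite fcD -scaleN1r fcZ mulN1r. Qed.

Lemma fc_normE u : `|u| = (supn (ev u))%:C.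
Proof. exact: c0_model_norm fc_model u. Qed.

Lemma fc_surj f : fibre_c0 f -> exists u : fibreC0, forall t, ev u t = f t.
Proof. exact: c0_model_surj fc_model f. Qed.

Lemma fc_le u t : normc (ev u t) <= supn (ev u).
Proof. by have [[k uk] _] := fcP u; exact: supn_ub uk. Qed.

End FibreVanishing.

(** * Module actions of l^1(S) *)

Section GradedActions.
Variables (R : realType) (S : choiceType) (T : Type) (deg : T -> S).
Local Notation C := R[i].
Local Notation l1 := (@Defs.summable R S).
Local Notation l1norm := (@Defs.l1norm R S).
Local Notation delta := (@Defs.delta R S).
Local Notation E := (fibreC0 R deg).
Implicit Types (f : T -> C) (a b : S -> C) (x y : E).

Lemma has_nsum_finite (p : S -> R) e : (forall i, 0 <= p i) -> has_nsum setT p ->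
  0 < e -> finite_set [set g | e <= p g].
Proof.
move=> p0 hp e0; apply: contrapT => inf.
(* One element more than the total mass divided by [e] leaves room for. *)
pose n := (Num.truncn (nsum setT p / e)).+1.
have [B BA nB] := infinite_set_fset n inf.
have : \sum_(i <- finmap.enum_fset B) p i <= nsum setT p.
  by apply: nsum_fin_le => //; exact: finmap.fset_uniq.
apply/negP; rewrite -ltNge; apply: (@lt_le_trans _ _ (n%:R * e)).
  by rewrite -ltr_pdivrMr// truncnS_gt.
apply: (@le_trans _ _ (\sum_(i <- finmap.enum_fset B) e)).
  by rewrite big_const_seq count_predT iter_addr_0 -[e *+ _]mulr_natl ler_pM2r// ler_nat.
rewrite big_seq [leRHS]big_seq; apply: ler_sum => i iB; exact: BA.
Qed.

(* [L k f t] only depends on [f] over the single fibre [sh k (deg t)]; injectivity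
   of [sh] in either argument is what cancellativity provides. *)
Record graded (L : S -> (T -> C) -> T -> C) : Prop := Graded {
  gradedD : forall k f g t, L k (fun s => f s + g s) t = L k f t + L k g t;
  gradedZ : forall k c f t, L k (fun s => c * f s) t = c * L k f t;
  graded_deg : exists sh : S -> S -> S,
    [/\ (forall k, injective (sh k)), (forall j, injective (sh^~ j))
      & forall k f B t, 0 <= B ->
          (forall s, deg s = sh k (deg t) -> normc (f s) <= B) ->
          normc (L k f t) <= 2 * B] }.

Definition act (L : S -> (T -> C) -> T -> C) a f : T -> C :=
  fun t => Defs.pair (fun k => L k f t) a.

Section one.
Variable L : S -> (T -> C) -> T -> C.
Hypothesis gL : graded L.

Lemma graded_le k f B t : 0 <= B -> (forall s, normc (f s) <= B) -> normc (L k f t) <= 2 * B.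
Proof. by move=> B0 fB; have [sh [_ _ h]] := graded_deg gL; apply: h. Qed.

Lemma graded_fc k f : fibre_c0 deg f -> fibre_c0 deg (L k f).
Proof.
move=> [[B fB] f0]; split.
  exists (2 * `|B|) => t; apply: graded_le => // s.
  by apply: le_trans (fB s) _; exact: ler_norm.
have [sh [i1 _ h]] := graded_deg gL.
(* With [e / 3] the factor 2 of [graded] still leaves a bound strictly below [e]. *)
move=> e e0; have e3 : 0 < e / 3 by rewrite divr_gt0.
apply: sub_finite_set (finite_preimage (f := sh k) _ (f0 _ e3)); last first.
  by move=> ? ? _ _; exact: i1.
move=> j /= [t tj et]; apply: contrapT => hn.
have : normc (L k f t) <= 2 * (e / 3).
  apply: h => [|s sj]; first exact: ltW.
  rewrite leNgt; apply/negP => /ltW hs; apply: hn; exists s => //.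
  by rewrite sj tj.
move=> /(le_trans et); lra.
Qed.

Lemma graded_bounded x t : forall k, normc (L k (ev x) t) <= 2 * supn (ev x).
Proof. by move=> k; apply: graded_le; [exact: supn_ge0|exact: fc_le]. Qed.

Lemma act_delta k f t : act L (delta k) f t = L k f t.
Proof. by rewrite /act pair_delta. Qed.

Lemma act_lin x t : l1lin (fun a => act L a (ev x) t).
Proof. by apply: l1lin_pair; eexists; exact: graded_bounded. Qed.

Lemma act_le a x t : l1 a -> normc (act L a (ev x) t) <= 4 * supn (ev x) * l1norm a.
Proof.
move=> ha; apply: le_trans (pair_le (graded_bounded x t) ha) _; lra.
Qed.

(** Vanishing along fibres survives uniform limits, and [act_le] makes [act] continuous in [a]
    uniformly in the point, so density of the unit vectors applies. *)
Lemma act_fc a x : l1 a -> fibre_c0 deg (act L a (ev x)).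
Proof.
move=> ha; split.
  by exists (4 * supn (ev x) * l1norm a) => t; exact: act_le.
move=> e e0; move: a ha e e0.
apply: l1_ind.
- move=> e e0; apply: sub_finite_set (finite_set0 _) => j [t _].
  by rewrite (l1lin0 (act_lin x t)) normc0 leNgt e0.
- move=> a b ha hb fa fb e e0; have e2 : 0 < e / 2 by rewrite divr_gt0.
  apply: sub_finite_set (_ : finite_set (_ `|` _)); last first.
    by rewrite finite_setU; split; [exact: (fa _ e2)|exact: (fb _ e2)].
  move=> j [t tj]; have [h1 _ _] := act_lin x t.
  rewrite h1// => et; have [h|h] := leP (e / 2) (normc (act L a (ev x) t)).
    by left; exists t.
  right; exists t => //; have := le_trans et (le_normcD _ _); lra.
- move=> c a ha fa e e0; have c1 : 0 < normc c + 1 by rewrite ltr_wpDl ?normc_ge0.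
  apply: sub_finite_set (fa _ (divr_gt0 e0 c1)) => j [t tj].
  have [_ h1 _] := act_lin x t; rewrite h1// normcM => et; exists t => //.
  rewrite ler_pdivrMr// mulrC; apply: le_trans et _.
  by rewrite ler_wpM2r ?normc_ge0// lerDl.
- move=> k e e0; have [_ h] := graded_fc k (fcP x).
  apply: sub_finite_set (h _ e0) => j [t tj].
  by rewrite act_delta => et; exists t.
- move=> a ha h e e0; pose d := e / 2 / (4 * supn (ev x) + 1).
  have s0 : 0 <= 4 * supn (ev x) by rewrite mulr_ge0 ?supn_ge0.
  have s1 : 0 < 4 * supn (ev x) + 1 by rewrite ltr_wpDl.
  have e2 : 0 < e / 2 by rewrite divr_gt0.
  have [b [hb fb hab]] := h d (divr_gt0 e2 s1).
  apply: sub_finite_set (fb _ e2) => j [t tj] et; exists t => //.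
  have [h1 _ _] := act_lin x t.
  have := act_le x t (l1B ha hb).
  have eq : act L a (ev x) t = act L (fun g => a g - b g) (ev x) t + act L b (ev x) t.
    by rewrite -h1//; [congr (act L _ (ev x) t); apply/funext => g; rewrite subrK|exact: l1B].
  have : 4 * supn (ev x) * l1norm (fun g => a g - b g) <= e / 2.
    apply: (@le_trans _ _ ((4 * supn (ev x) + 1) * d)); last by rewrite /d mulrC divfK// gt_eqF.
    by apply: ler_pM => //; [exact: l1norm_ge0|rewrite lerDl].
  move: et; rewrite eq => et; have := le_trans et (le_normcD _ _); lra.
Qed.

End one.

(* Sealed, like [c0_space]. *)
Lemma act_operator L : {F : (S -> C) -> E -> E | graded L ->
  forall a x t, l1 a -> ev (F a x) t = act L a (ev x) t}.
Proof.
apply: cid; have [gL|ngL] := pselect (graded L); last by exists (fun _ x => x).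
have /choice[F hF] : forall p : (S -> C) * E, exists y : E, l1 p.1 ->
    forall t, ev y t = act L p.1 (ev p.2) t.
  move=> [a x]; have [ha|nha] := pselect (l1 a); last by exists 0.
  by have [y hy] := fc_surj (act_fc gL x ha); exists y => _ t; rewrite hy.
by exists (fun a x => F (a, x)) => _ a x t ha; rewrite hF.
Qed.

Definition acte L : (S -> C) -> E -> E := sval (act_operator L).

Section operator.
Variable L : S -> (T -> C) -> T -> C.
Hypothesis gL : graded L.
Local Notation acte := (acte L).

Lemma acteE a x t : l1 a -> ev (acte a x) t = act L a (ev x) t.
Proof. exact: (svalP (act_operator L)). Qed.

Lemma acte_delta k x t : ev (acte (delta k) x) t = L k (ev x) t.
Proof.
rewrite acteE; last by have [] := delta_l1 R k.
exact: act_delta.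
Qed.

Lemma acteD a x y : l1 a -> acte a (x + y) = acte a x + acte a y.
Proof.
move=> ha; apply: fc_ext => t; apply: etrans (esym (fcD _ _ t)).
apply: etrans (acteE (x + y) t ha) _.
apply: etrans (esym (congr2 +%R (acteE x t ha) (acteE y t ha))).
have bd (z : E) : Defs.bounded (fun k => L k (ev z) t) by eexists; exact: graded_bounded.
apply: etrans (pairDl (bd x) (bd y) ha).
congr (Defs.pair _ a); apply: funext => k; apply: etrans (gradedD gL k (ev x) (ev y) t).
by congr (L k _ t); apply/funext => s; exact: fcD.
Qed.

Lemma acteZ a c x : l1 a -> acte a (c *: x) = c *: acte a x.
Proof.
move=> ha; apply: fc_ext => t; apply: etrans (esym (fcZ c _ t)).
apply: etrans (acteE (c *: x) t ha) _.
apply: etrans (esym (congr1 ( *%R c) (acteE x t ha))).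
have bd (z : E) : Defs.bounded (fun k => L k (ev z) t) by eexists; exact: graded_bounded.
apply: etrans (pairZl c (bd x) ha).
congr (Defs.pair _ a); apply: funext => k; apply: etrans (gradedZ gL k c (ev x) t).
by congr (L k _ t); apply/funext => s; exact: fcZ.
Qed.

Lemma acteDl a b x : l1 a -> l1 b -> acte (fun g => a g + b g) x = acte a x + acte b x.
Proof.
move=> ha hb; apply: fc_ext => t; apply: etrans (esym (fcD _ _ t)).
apply: etrans (acteE x t (l1D ha hb)) _.
apply: etrans (esym (congr2 +%R (acteE x t ha) (acteE x t hb))).
by have [h _ _] := act_lin gL x t; exact: h.
Qed.

Lemma acteZl c a x : l1 a -> acte (fun g => c * a g) x = c *: acte a x.
Proof.
move=> ha; apply: fc_ext => t; apply: etrans (esym (fcZ c _ t)).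
apply: etrans (acteE x t (l1Z c ha)) _.
apply: etrans (esym (congr1 ( *%R c) (acteE x t ha))).
by have [_ h _] := act_lin gL x t; exact: h.
Qed.

Lemma acte_lin x t : l1lin (fun a => ev (acte a x) t).
Proof.
split=> [a b ha hb|c a ha|]; first by rewrite (acteDl x ha hb) [LHS]fcD.
  by rewrite (acteZl c x ha) [LHS]fcZ.
by exists (4 * supn (ev x)) => a ha; rewrite (acteE x t ha); exact: act_le.
Qed.

Lemma supn_acte a x : l1 a -> supn (ev (acte a x)) <= 4 * l1norm a * supn (ev x).
Proof.
move=> ha; apply: supn_le => [|t].
  by rewrite !mulr_ge0 ?l1norm_ge0 ?supn_ge0.
by rewrite acteE// mulrAC; exact: act_le.
Qed.

End operator.

(** Separate bounded linearity of a composite of two actions, in the shape that [l1bilin_ext]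
    requires. *)
Lemma act_act_lin P Q x t : graded P -> graded Q ->
  (forall b, l1 b -> l1lin (fun a => ev (acte P a (acte Q b x)) t)) /\
  (forall a, l1 a -> l1lin (fun b => ev (acte P a (acte Q b x)) t)).
Proof.
move=> gP gQ; split=> [b hb|a ha]; first exact: acte_lin.
split=> [b b' hb hb'|c b hb|].
- by rewrite (acteDl gQ x hb hb') (acteD gP _ _ ha) [LHS]fcD.
- by rewrite (acteZl gQ c x hb) (acteZ gP c _ ha) [LHS]fcZ.
- exists (4 * l1norm a * (4 * supn (ev x))) => b hb.
  apply: le_trans (fc_le _ _) _; apply: le_trans (supn_acte gP _ ha) _.
  rewrite -!mulrA ler_wpM2l// ler_wpM2l ?l1norm_ge0//.
  by apply: le_trans (supn_acte gQ _ hb) _; rewrite -mulrA [supn (ev x) * _]mulrC.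
Qed.

Lemma act_act_delta P Q g h x t : graded P -> graded Q ->
  ev (acte P (delta g) (acte Q (delta h) x)) t = P g (Q h (ev x)) t.
Proof.
move=> gP gQ; rewrite acte_delta//; congr (P g _ t).
by apply/funext => s; rewrite acte_delta.
Qed.

End GradedActions.

(** * Bounded functionals on complex Banach spaces *)

Section DualFunctionals.
Variables (R : realType) (E : normedModType R[i]).
Local Notation C := R[i].
Implicit Types (phi : E -> C) (x : E).

(** Norms over [C] take values in [C]; this is the same number in [R], where the estimates are
    made. *)
Definition rnorm x : R := complex.Re `|x|.

Lemma rnormE x : `|x| = (rnorm x)%:C.
Proof. by rewrite /rnorm RRe_real// normr_real. Qed.

Lemma rnorm_ge0 x : 0 <= rnorm x.
Proof. by rewrite -ler0c -rnormE normr_ge0. Qed.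

Lemma is_dual_bound phi : is_dual phi ->
  exists2 k : R, 0 <= k & forall x, normc (phi x) <= k * rnorm x.
Proof.
move=> [_ _ [k h]]; exists `|k| => // x.
have := h x; rewrite normC_E rnormE -rmorphM lecR => /le_trans; apply.
by rewrite ler_wpM2r ?rnorm_ge0// ler_norm.
Qed.

Lemma is_dual_intro phi (k : R) : (forall x y, phi (x + y) = phi x + phi y) ->
  (forall c x, phi (c *: x) = c * phi x) -> (forall x, normc (phi x) <= k * rnorm x) ->
  is_dual phi.
Proof.
move=> h1 h2 h3; split => //; exists k => x.
by rewrite normC_E rnormE -rmorphM lecR.
Qed.

Lemma is_dual0 phi : is_dual phi -> phi 0 = 0.
Proof. by move=> [_ h _]; rewrite -(scale0r 0) h mul0r. Qed.

Lemma is_dual_sum phi (I : Type) (s : seq I) (F : I -> E) : is_dual phi ->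
  phi (\sum_(i <- s) F i) = \sum_(i <- s) phi (F i).
Proof.
move=> hp; elim: s => [|i s IH]; first by rewrite !big_nil is_dual0.
by rewrite !big_cons -IH; case: hp => ->.
Qed.

End DualFunctionals.

Lemma unimodular (R : realType) (z : R[i]) :
  exists2 u : R[i], u * z = (normc z)%:C & normc u <= 1.
Proof.
have [->|z0] := eqVneq z 0; first by exists 0; rewrite ?mul0r normc0 ?ler01.
exists ((normc z)%:C / z); first by rewrite divfK.
rewrite normcM normcV normcR ger0_norm ?normc_ge0// divff//.
by apply: contra z0 => /eqP/eq0_normc ->.
Qed.

(** * Vanishing at infinity and normality of graded actions *)

Section VanishingAtInfinity.
Variables (R : realType) (S : choiceType).
Local Notation C := R[i].
Local Notation l1 := (@Defs.summable R S).
Local Notation delta := (@Defs.delta R S).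

Lemma c0_bounded (f : S -> C) : Defs.c0 f -> Defs.bounded f.
Proof.
move=> h; have fin := h 1 ltr01.
exists (1 + \sum_(g <- finmap.enum_fset (fset_set [set g | 1 <= normc (f g)])) normc (f g)).
move=> g; have n0 i : 0 <= normc (f i) := normc_ge0 _.
have [g1|g1] := leP 1 (normc (f g)); last first.
  by apply: (le_trans (ltW g1)); rewrite lerDl sumr_ge0.
have gin : g \in finmap.enum_fset (fset_set [set g | 1 <= normc (f g)]).
  by rewrite in_fset_set// inE.
rewrite (big_rem g)//= addrCA lerDl addr_ge0// ?sumr_ge0//.
Qed.

Lemma c0_approx (f : S -> C) :
  (forall e, 0 < e -> exists2 f', Defs.c0 f' & forall g, normc (f g - f' g) <= e) ->
  Defs.c0 f.
Proof.
move=> h e e0; have e2 : 0 < e / 2 by rewrite divr_gt0.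
have [f' f'0 ff'] := h _ e2; apply: sub_finite_set (f'0 _ e2) => g /= ge.
have : normc (f g) <= e / 2 + normc (f' g).
  rewrite -{1}[f g](subrK (f' g)); apply: le_trans (le_normcD _ _) _.
  by rewrite lerD2r.
move=> /(le_trans ge); lra.
Qed.

Lemma l1_c0 (f : S -> C) : has_nsum setT (fun g => normc (f g)) -> Defs.c0 f.
Proof. by move=> h e e0; apply: has_nsum_finite => // g; exact: normc_ge0. Qed.

Lemma c0D (f f' : S -> C) : Defs.c0 f -> Defs.c0 f' -> Defs.c0 (fun k => f k + f' k).
Proof.
move=> h1 h2 e e0; have e2 : 0 < e / 2 by rewrite divr_gt0.
apply: sub_finite_set (_ : finite_set (_ `|` _)); last first.
  by rewrite finite_setU; split; [exact: (h1 _ e2)|exact: (h2 _ e2)].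
move=> g /= h; have [h'|h'] := leP (e / 2) (normc (f g)); [by left|right => /=].
have := le_trans h (le_normcD _ _); lra.
Qed.

Lemma c0Z c (f : S -> C) : Defs.c0 f -> Defs.c0 (fun k => c * f k).
Proof.
move=> h e e0; have c1 : 0 < normc c + 1 by rewrite ltr_wpDl ?normc_ge0.
apply: sub_finite_set (h _ (divr_gt0 e0 c1)) => g /=; rewrite normcM => et.
rewrite ler_pdivrMr// mulrC; apply: le_trans et _.
by rewrite ler_wpM2r ?normc_ge0// lerDl.
Qed.

(** Each test vector contributes a single predual functional, and the tolerance is kept
    unchanged. *)
Lemma wcont_c0 (E : completeNormedModType C) op w (F : (S -> C) -> E -> C) :
  (forall x, exists2 f, Defs.c0 f & forall a, l1 a -> F a x = Defs.pair f a) ->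
  wcont (B := l1alg op w) (c0_predual R S) F.
Proof.
move=> h a0 ha0 n xs e e0.
have /choice[f hf] : forall j, exists f, Defs.c0 f /\
    forall a, l1 a -> F a (xs j) = Defs.pair f a.
  by move=> j; have [f ? ?] := h (xs j); exists f.
exists n, (fun j => Defs.pair (f j)), e; split => //.
  by move=> i; exists (f i); split => //; have [] := hf i.
by move=> a ha hd j; have [_ hj] := hf j; rewrite !hj.
Qed.

Section graded.
Variables (T : Type) (deg : T -> S).
Local Notation E := (fibreC0 R deg).

Lemma supnE (x : E) : rnorm x = supn (ev x).
Proof. by rewrite /rnorm fc_normE. Qed.

Lemma fc_sumE (I : Type) (s : seq I) (F : I -> E) t :
  ev (\sum_(i <- s) F i) t = \sum_(i <- s) ev (F i) t.
Proof.
elim: s => [|i s IH]; first by rewrite !big_nil fc0.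
by rewrite !big_cons fcD IH.
Qed.

Lemma fc_truncate (x : E) e : 0 < e -> exists (J : seq S) (y : E),
  [/\ supn (ev (x - y)) <= e, supn (ev y) <= supn (ev x) & forall t, deg t \notin J -> ev y t = 0].
Proof.
move=> e0; have [_ /(_ e e0) fin] := fcP x.
set A := [set j | _] in fin.
pose J := finmap.enum_fset (fset_set A).
have JE j : (j \in J) = (j \in A) by exact: in_fset_set.
pose f t := if deg t \in J then ev x t else 0.
have fle t : normc (f t) <= normc (ev x t).
  by rewrite /f; case: ifP; rewrite ?normc0 ?normc_ge0.
have [|y yf] := @fc_surj _ _ _ deg f.
  split; first by exists (supn (ev x)) => t; apply: le_trans (fle t) _; exact: fc_le.
  move=> d d0; have [_ /(_ d d0)] := fcP x; apply: sub_finite_set.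
  by move=> j [t tj dt]; exists t => //; exact: le_trans (fle t).
exists J, y; split.
- apply: supn_le => [|t]; first exact: ltW.
  rewrite fcB yf /f JE; case: ifPn; first by rewrite subrr normc0 ltW.
  rewrite notin_setE subr0 => /= hA; rewrite leNgt; apply/negP => /ltW h.
  by apply: hA; exists t.
- apply: supn_le => [|t]; first exact: supn_ge0.
  by rewrite yf; apply: le_trans (fle t) _; exact: fc_le.
- by move=> t /negbTE tJ; rewrite yf /f tJ.
Qed.

(** Truncating [x] to finitely many fibres [J] costs an error uniform in [k]. For the truncation [y]
    the values of [phi] are even summable: phases [th k] align them, so that their absolute sum is
    the modulus of [phi z] for one vector [z], and at each point at most [size J] of the terms of
    [z] are nonzero. *)
Lemma dual_graded_c0 L (phi : E -> C) (x : E) : graded deg L -> is_dual phi ->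
  Defs.c0 (fun k => phi (acte L (delta k) x)).
Proof.
move=> gL dphi; have [K K0 hK] := is_dual_bound dphi.
apply: c0_approx => e e0.
(* The 4 is the constant of [supn_acte], namely 2 from [pair_le] times 2 from [graded]; adding 1
   keeps the divisor positive. *)
have K4 : 0 < 4 * K + 1 by rewrite ltr_wpDl// mulr_ge0.
have [J [y [xy yx yJ]]] := fc_truncate x (divr_gt0 e0 K4).
exists (fun k => phi (acte L (delta k) y)); last first.
  move=> k; have [dl nd] := delta_l1 R k.
  have [h1 _ _] := dphi.
  have -> : phi (acte L (delta k) x) =
      phi (acte L (delta k) (x - y)) + phi (acte L (delta k) y).
    apply: etrans (h1 _ _); congr phi.
    exact: etrans (congr1 (acte L _) (esym (subrK y x))) (acteD gL _ _ dl).
  rewrite addrK.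
  apply: le_trans (hK _) _; rewrite supnE.
  have := supn_acte gL (x - y) dl; rewrite nd mulr1 => h.
  apply: le_trans (ler_wpM2l K0 h) _.
  rewrite mulrCA mulrA; apply: (@le_trans _ _ ((4 * K + 1) * (e / (4 * K + 1)))).
    apply: ler_pM => //; [by rewrite mulr_ge0|exact: supn_ge0|by rewrite lerDl].
  by rewrite mulrC divfK// gt_eqF.
apply: l1_c0; apply: (@has_nsumP _ _ _ _ (K * ((size J)%:R * (2 * supn (ev x))))) => s us _.
have /choice[th hth] : forall k, exists u : C,
    u * phi (acte L (delta k) y) = (normc (phi (acte L (delta k) y)))%:C /\ normc u <= 1.
  by move=> k; have [u ? ?] := unimodular (phi (acte L (delta k) y)); exists u.
pose z := \sum_(k <- s) th k *: acte L (delta k) y.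
have -> : \sum_(k <- s) normc (phi (acte L (delta k) y)) = normc (phi z).
  have thE k : phi (th k *: acte L (delta k) y) = (normc (phi (acte L (delta k) y)))%:C.
    by case: (dphi) => _ h2 _; rewrite h2 (hth k).1.
  rewrite /z (is_dual_sum s _ dphi) (eq_bigr _ (fun k _ => thE k)).
  rewrite -rmorph_sum normcR ger0_norm// sumr_ge0// => k _; exact: normc_ge0.
apply: le_trans (hK _) _; rewrite ler_wpM2l// supnE.
have x0 := supn_ge0 (ev x).
apply: supn_le => [|t]; first by rewrite !mulr_ge0.
have [sh [_ i2 hsh]] := graded_deg gL.
rewrite fc_sumE.
(* At [t] the term of index [k] only sees [y] over the fibre of [sh k (deg t)]. Injectivity in [k]
   then bounds the number of surviving terms by [size J]. *)
apply: (@le_trans _ _ (\sum_(k <- s) (if sh k (deg t) \in J then 2 * supn (ev x) else 0))).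
  elim: (s) => [|k s' IH]; first by rewrite !big_nil normc0.
  rewrite !big_cons; apply: le_trans (le_normcD _ _) _; apply: lerD => //.
  rewrite fcZ normcM; apply: le_trans (_ : _ <= normc (ev (acte L (delta k) y) t)) _.
    by rewrite ler_piMl ?normc_ge0// (hth k).2.
  rewrite acte_delta//; case: ifPn => hJ.
    by apply: hsh => // r _; apply: le_trans (fc_le _ _) yx.
  rewrite -(mulr0 2); apply: hsh => // r hr.
  by rewrite yJ ?normc0// hr.
rewrite -big_mkcond/= big_const_seq iter_addr_0 -[_ *+ _]mulr_natl.
rewrite ler_wpM2r ?mulr_ge0// ler_nat -size_filter.
rewrite -(size_map (fun k => sh k (deg t))); apply: uniq_leq_size.
  by rewrite map_inj_uniq ?filter_uniq//; exact: i2.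
by move=> _ /mapP[k + ->]; rewrite mem_filter => /andP[].
Qed.

End graded.
End VanishingAtInfinity.

(** * Bimodules over [l^1(S, omega)] built from graded actions *)

Section ActionBimodule.
Variables (R : realType) (S : choiceType) (op : S -> S -> S) (w : S -> R).
Hypothesis w_gt0 : forall s, 0 < w s.
Hypothesis w_sub : forall s t, w (op s t) <= w s * w t.
Variables (T : Type) (deg : T -> S).
Local Notation C := R[i].
Local Notation l1 := (@Defs.summable R S).
Local Notation delta := (@Defs.delta R S).
Local Notation conv := (Defs.conv op w).
Local Notation Om := (Defs.Omega op w).
Local Notation E := (fibreC0 R deg).
Variables (L Q : S -> (T -> C) -> T -> C).
Hypotheses (gL : graded deg L) (gQ : graded deg Q).
Hypothesis LL : forall i j f t, (Om i j)%:C * L (op i j) f t = L i (L j f) t.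
Hypothesis QQ : forall i j f t, (Om i j)%:C * Q (op i j) f t = Q j (Q i f) t.
Hypothesis LQ : forall i j f t, L i (Q j f) t = Q j (L i f) t.

Lemma acte_conv_delta P g h (x : E) t : graded deg P ->
  ev (acte P (conv (delta g) (delta h)) x) t = (Om g h)%:C * P (op g h) (ev x) t.
Proof.
move=> gP; rewrite conv_delta; have [_ h1 _] := acte_lin gP x t.
have [hd _] := delta_l1 R (op g h).
by rewrite (h1 _ _ hd) (acte_delta gP).
Qed.

Lemma acte_bimodule : is_bimodule (B := l1alg op w) (E := E)
  (acte L) (fun x a => acte Q a x).
Proof.
split; first split.
- by move=> a b x ha hb; split; apply: acteDl.
- by move=> c a x ha; split; apply: acteZl.
- by move=> a x y ha; split; apply: acteD.
- by move=> a c x ha; split; apply: acteZ.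
- exists 4 => a x ha; rewrite !fc_normE -!rmorphM !lecR.
  by split; apply: supn_acte.
have cl P (x : E) t b : graded deg P -> l1 b ->
    l1lin (fun a => ev (acte P (conv a b) x) t).
  by move=> gP hb; apply: (l1lin_convl w_gt0 w_sub (acte_lin gP x t)).
have cr P (x : E) t a : graded deg P -> l1 a ->
    l1lin (fun b => ev (acte P (conv a b) x) t).
  by move=> gP ha; apply: (l1lin_convr w_gt0 w_sub (acte_lin gP x t)).
move=> a b x ha hb; split; apply: fc_ext => t.
- have [LL1 LL2] := act_act_lin x t gL gL.
  apply: (l1bilin_ext (F := fun a b => ev (acte L (conv a b) x) t)
    (G := fun a b => ev (acte L a (acte L b x)) t)) => //.
  + by move=> a' ha'; exact: cr.
  + by move=> b' hb'; exact: cl.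
  + by move=> g h; rewrite act_act_delta// acte_conv_delta.
- have [QQ1 QQ2] := act_act_lin x t gQ gQ.
  apply: (l1bilin_ext (F := fun a b => ev (acte Q (conv a b) x) t)
    (G := fun a b => ev (acte Q b (acte Q a x)) t)) => //.
  + by move=> a' ha'; exact: cr.
  + by move=> b' hb'; exact: cl.
  + by move=> g h; rewrite act_act_delta// acte_conv_delta.
- have [h1 h2] := act_act_lin x t gL gQ; have [h3 h4] := act_act_lin x t gQ gL.
  apply: (l1bilin_ext (F := fun a b => ev (acte L a (acte Q b x)) t)
    (G := fun a b => ev (acte Q b (acte L a x)) t)) => //.
  by move=> g h; rewrite !act_act_delta.
Qed.

Lemma dual_acte_lin P (phi : E -> C) (x : E) : graded deg P -> is_dual phi ->
  l1lin (fun a => phi (acte P a x)).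
Proof.
move=> gP dphi; have [K K0 hK] := is_dual_bound dphi.
case: dphi => h1 h2 _; split.
- by move=> b c hb hc; rewrite acteDl// h1.
- by move=> c b hb; rewrite acteZl// h2.
- exists (K * (4 * supn (ev x))) => b hb; apply: le_trans (hK _) _.
  rewrite -mulrA ler_wpM2l// supnE mulrAC; exact: supn_acte.
Qed.

(** This is the normality of the dual module. By [dual_graded_c0] both orbit maps of [phi], tested
    on a vector, are pairings with [c_0] functions. *)
Lemma acte_wcont (phi : E -> C) : is_dual phi ->
  wcont (B := l1alg op w) (c0_predual R S)
    (fun a => dl (B := l1alg op w) (fun x a => acte Q a x) a phi) /\
  wcont (B := l1alg op w) (c0_predual R S) (fun a => dr (B := l1alg op w) (acte L) phi a).
Proof.
move=> dphi; split; apply: wcont_c0 => x.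
- exists (fun k => phi (acte Q (delta k) x)); first exact: dual_graded_c0.
  by move=> a ha; rewrite /dl /dr (l1lin_pairE (dual_acte_lin x _ dphi) ha).
- exists (fun k => phi (acte L (delta k) x)); first exact: dual_graded_c0.
  by move=> a ha; rewrite /dl /dr (l1lin_pairE (dual_acte_lin x _ dphi) ha).
Qed.

End ActionBimodule.

(** * The Hochschild module *)

Section HochschildModule.
Variables (R : realType) (S : choiceType) (op : S -> S -> S) (w : S -> R).
Hypothesis opA : associative op.
Hypothesis opC : cancellative op.
Hypothesis w_gt0 : forall s, 0 < w s.
Hypothesis w_sub : forall s t, w (op s t) <= w s * w t.
Local Notation C := R[i].
Local Notation l1 := (@Defs.summable R S).
Local Notation delta := (@Defs.delta R S).
Local Notation conv := (Defs.conv op w).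
Local Notation Om := (Defs.Omega op w).
Local Notation T := (option S * S)%type.

(* Functions on [option S * S] are bilinear forms on (l^1 with a unit adjoined) x l^1;
   [None] is the adjoined unit, so that the module is available before [S] is known
   to have a unit.  [hleft] is the dimension-shifting left action
   f |-> f(g, hk) - f(gh, k): with it, [hder], i.e. f |-> f(1, k), is a derivation. *)
Definition lmulo (o : option S) (h : S) : S := if o is Some g then op g h else h.
Definition rmulo (k : S) (o : option S) : S := if o is Some g then op k g else k.
Definition lOm (o : option S) (h : S) : R := if o is Some g then Om g h else 1.
Definition rOm (k : S) (o : option S) : R := if o is Some g then Om k g else 1.

Definition hdeg (t : T) : S := lmulo t.1 t.2.
Local Notation E := (fibreC0 R hdeg).
Implicit Types x y : E.

Definition hright (k : S) (f : T -> C) : T -> C :=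
  fun t => (rOm k t.1)%:C * f (Some (rmulo k t.1), t.2).
Definition hleft (k : S) (f : T -> C) : T -> C :=
  fun t => (Om t.2 k)%:C * f (t.1, op t.2 k) - (lOm t.1 t.2)%:C * f (Some (lmulo t.1 t.2), k).

Let lOm01 q h : 0 <= lOm q h <= 1.
Proof. by case: q => [g|] /=; rewrite ?ler01 ?lexx// ltW ?Omega_le1 ?Omega_gt0. Qed.

Let rOm01 k q : 0 <= rOm k q <= 1.
Proof. by case: q => [g|] /=; rewrite ?ler01 ?lexx// ltW ?Omega_le1 ?Omega_gt0. Qed.

Let scal_le (r : R) (z : C) B : 0 <= r <= 1 -> normc z <= B -> normc (r%:C * z) <= B.
Proof.
move=> /andP[r0 r1] zB; rewrite normcM normcR ger0_norm//.
by apply: le_trans zB; rewrite ler_piMl ?normc_ge0.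
Qed.

Lemma hright_graded : graded hdeg hright.
Proof.
split; [by move=> *; rewrite /hright mulrDr|by move=> *; rewrite /hright mulrCA|].
exists op; split; [by move=> k; case: (opC k)|by move=> j; case: (opC j)|].
move=> k f B [q h] B0 fB; apply: (@le_trans _ _ B); last by rewrite mulr_natl mulr2n lerDl.
by apply: scal_le (rOm01 _ _) _; apply: fB; rewrite /hdeg/=; case: q => //= g; rewrite opA.
Qed.

(** Both terms of [hleft k f] at [t] are evaluated over the fibre of [op (hdeg t) k]. Having two of
    them accounts for the factor 2 in [graded]. *)
Lemma hleft_graded : graded hdeg hleft.
Proof.
split; [by move=> *; rewrite /hleft; ring|by move=> *; rewrite /hleft; ring|].
exists (fun k j => op j k); split; [by move=> k; case: (opC k)|by move=> j; case: (opC j)|].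
move=> k f B [q h] B0 fB; rewrite mulr_natl mulr2n.
apply: le_trans (le_normcD _ _) _; rewrite normcN; apply: lerD.
  apply: scal_le; first by rewrite Omega_le1// ltW// Omega_gt0.
  by apply: fB; rewrite /hdeg/=; case: q => //= g; rewrite opA.
by apply: scal_le (lOm01 _ _) _; apply: fB.
Qed.

Let cocycle g h j : (Om g (op h j))%:C * (Om h j)%:C = (Om (op g h) j)%:C * (Om g h)%:C :> C.
Proof. by rewrite -!rmorphM Omega_cocycle. Qed.

(** Expanding the composite produces two terms with last argument [j], both at the first argument
    [lmulo q h] multiplied by [i]; they cancel by the cocycle identity. *)
Lemma hleft_mul i j f t : (Om i j)%:C * hleft (op i j) f t = hleft i (hleft j f) t.
Proof.
case: t => q h; rewrite /hleft/=.
have c1 := cocycle h i j.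
have c2 : (lOm q (op h i))%:C * (Om h i)%:C = (Om (lmulo q h) i)%:C * (lOm q h)%:C :> C.
  by case: q => [g|] /=; rewrite ?mul1r ?mulr1.
have -> : lmulo q (op h i) = op (lmulo q h) i by case: q {c2} => //= g; rewrite opA.
rewrite -[op (op h i) j]opA.
rewrite !mulrBr !mulrA [(Om i j)%:C * (Om h _)%:C]mulrC c1 [(Om h i)%:C * _]mulrC.
rewrite [(Om h i)%:C * (lOm _ _)%:C]mulrC c2.
ring.
Qed.

Lemma hright_mul i j f t : (Om i j)%:C * hright (op i j) f t = hright j (hright i f) t.
Proof.
case: t => q h; rewrite /hright/=.
case: q => [g|] /=; last by rewrite !mul1r.
by rewrite -opA mulrCA mulrA -cocycle; ring.
Qed.

Lemma hleft_hright i j f t : hleft i (hright j f) t = hright j (hleft i f) t.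
Proof.
case: t => q h; rewrite /hleft /hright/=; case: q => [g|] /=.
  rewrite mulrBr -opA !mulrA [(Om j g)%:C * (Om (op j g) h)%:C]mulrC -cocycle.
  ring.
by rewrite !mul1r.
Qed.

Definition hder (a : S -> C) (x : E) : C := Defs.pair (fun k => ev x (None, k)) a.

Lemma hder_bounded x k : normc (ev x (None, k)) <= supn (ev x).
Proof. exact: fc_le. Qed.

Lemma hder_delta k x : hder (delta k) x = ev x (None, k).
Proof. by rewrite /hder pair_delta. Qed.

Lemma hder_dual a : l1 a -> is_dual (hder a).
Proof.
move=> ha; apply: (@is_dual_intro _ _ _ (2 * Defs.l1norm a)).
- move=> x y; rewrite /hder -pairDl//; [|by eexists; exact: hder_bounded..].
  by congr (Defs.pair _ a); apply: funext => k; exact: fcD.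
- move=> c x; rewrite /hder -pairZl//; last by eexists; exact: hder_bounded.
  by congr (Defs.pair _ a); apply: funext => k; exact: fcZ.
- move=> x; apply: le_trans (pair_le (hder_bounded x) ha) _.
  by rewrite supnE -mulrA [supn _ * _]mulrC.
Qed.

Lemma hder_lin x : l1lin (hder^~ x).
Proof. by apply: l1lin_pair; eexists; exact: hder_bounded. Qed.

(** On unit vectors the Leibniz rule telescopes: [x(g, h)] from the right action cancels the
    subtracted term of [hleft], which leaves [Omega(g, h) x(1, gh)]. *)
Lemma hder_derivation : is_derivation (B := l1alg op w) (E := E)
  (acte hleft) (fun x a => acte hright a x) hder.
Proof.
have gL := hleft_graded; have gR := hright_graded.
split.
- exact: hder_dual.
- by move=> a b ha hb; apply: funext => x; case: (hder_lin x) => h _ _; exact: h.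
- by move=> c a ha; apply: funext => x; case: (hder_lin x) => _ h _; exact: h.
move=> a b ha hb; apply: funext => x.
apply: (l1bilin_ext (F := fun a b => hder (conv a b) x)
  (G := fun a b => hder b (acte hright a x) + hder a (acte hleft b x))) => //.
- by move=> a' ha'; apply: (l1lin_convr w_gt0 w_sub (hder_lin x)).
- by move=> b' hb'; apply: (l1lin_convl w_gt0 w_sub (hder_lin x)).
- move=> a' ha'; apply: l1linD; first exact: hder_lin.
  exact: (dual_acte_lin x gL (hder_dual ha')).
- move=> b' hb'; apply: l1linD; last exact: hder_lin.
  exact: (dual_acte_lin x gR (hder_dual hb')).
move=> g h; rewrite !hder_delta !acte_delta// conv_delta.
have [hd _] := delta_l1 R (op g h).
case: (hder_lin x) => _ h2 _; rewrite (h2 _ _ hd) hder_delta /hright /hleft/=.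
by rewrite !mul1r addrC subrK.
Qed.

(** The point [(None, k)] lies over [k], so vanishing along fibres makes [k |-> x(1, k)] a function
    in [c_0(S)]. *)
Lemma hder_wcont : wcont (B := l1alg op w) (E := E) (c0_predual R S) hder.
Proof.
apply: wcont_c0 => x; exists (fun k => ev x (None, k)) => // e e0.
have [_ /(_ e e0)] := fcP x; apply: sub_finite_set => k /= ke.
by exists (None, k).
Qed.

Lemma connes_amenable_hder : connes_amenable (l1alg op w) (c0_predual R S) ->
  exists phi : E -> C, is_dual phi /\ forall k x,
    ev x (None, k) = phi (acte hright (delta k) x) - phi (acte hleft (delta k) x).
Proof.
move=> /(_ _ _ _ (acte_bimodule w_gt0 w_sub hleft_graded hright_graded
  hleft_mul hright_mul hleft_hright)).
move=> /(_ (fun phi => acte_wcont op w hleft_graded hright_graded (phi := phi))).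
move=> /(_ _ hder_derivation hder_wcont)[phi [dphi hphi]].
exists phi; split => // k x.
have [hd _] := delta_l1 R k.
by rewrite -hder_delta (hphi _ hd).
Qed.

End HochschildModule.

(** * Virtual diagonals *)

Section VirtualDiagonal.
Variables (R : realType) (S : choiceType) (op : S -> S -> S) (w : S -> R).
Hypothesis opA : associative op.
Hypothesis opC : cancellative op.
Hypothesis w_gt0 : forall s, 0 < w s.
Hypothesis w_sub : forall s t, w (op s t) <= w s * w t.
Local Notation C := R[i].
Local Notation delta := (@Defs.delta R S).
Local Notation Om := (Defs.Omega op w).
Implicit Types y z : S * S -> C.

Definition pdeg (p : S * S) : S := op p.1 p.2.

Lemma fibre_c0_single (T : Type) (deg : T -> S) (f : T -> C) j B :
  (forall t, normc (f t) <= B) -> (forall t, deg t <> j -> f t = 0) -> fibre_c0 deg f.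
Proof.
move=> fB f0; split; first by exists B.
move=> e e0; apply: sub_finite_set (finite_set1 j) => i [t ti et].
apply: contrapT => ij; move: et.
by rewrite f0 ?normc0 ?leNgt ?e0// ti.
Qed.

(* The actions of [delta k] on bounded bilinear forms [y] on l^1, dual to the
   actions on the projective tensor square. *)
Definition pright (k : S) y : S * S -> C := fun p => (Om k p.1)%:C * y (op k p.1, p.2).
Definition pleft (k : S) y : S * S -> C := fun p => (Om p.2 k)%:C * y (p.1, op p.2 k).

Lemma pright_graded : graded pdeg pright.
Proof.
split; [by move=> *; rewrite /pright mulrDr|by move=> *; rewrite /pright mulrCA|].
exists op; split; [by move=> k; case: (opC k)|by move=> j; case: (opC j)|].
move=> k f B [g h] B0 fB; rewrite mulr_natl mulr2n -[leLHS]addr0; apply: lerD => //.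
apply: le_trans (normc_Omega_le w_gt0 w_sub _ _ _) _; apply: fB.
by rewrite /pdeg/= opA.
Qed.

Lemma pleft_graded : graded pdeg pleft.
Proof.
split; [by move=> *; rewrite /pleft mulrDr|by move=> *; rewrite /pleft mulrCA|].
exists (fun k j => op j k); split; [by move=> k; case: (opC k)|by move=> j; case: (opC j)|].
move=> k f B [g h] B0 fB; rewrite mulr_natl mulr2n -[leLHS]addr0; apply: lerD => //.
apply: le_trans (normc_Omega_le w_gt0 w_sub _ _ _) _; apply: fB.
by rewrite /pdeg/= opA.
Qed.

(* The pull-back of the indicator of [u] under multiplication. *)
Definition unit_kernel (u : S) : S * S -> C :=
  fun p => if op p.1 p.2 == u then (Om p.1 p.2)%:C else 0.

(** An analogue of a virtual diagonal that is tested only on forms vanishing along fibres, and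
    normalised only at the unit. As forms are plain functions, boundedness is phrased with an
    arbitrary bound [B] in place of a norm. *)
Record virtual_diagonal (u : S) (M : (S * S -> C) -> C) : Prop := VirtualDiagonal {
  vdD : forall y z, fibre_c0 pdeg y -> fibre_c0 pdeg z ->
    M (fun p => y p + z p) = M y + M z;
  vdZ : forall c y, fibre_c0 pdeg y -> M (fun p => c * y p) = c * M y;
  vd_bound : exists2 K : R, 0 <= K & forall y B, 0 <= B -> fibre_c0 pdeg y ->
    (forall p, normc (y p) <= B) -> normc (M y) <= K * B;
  vd_comm : forall k y, fibre_c0 pdeg y -> M (pright k y) = M (pleft k y);
  vd_unit : M (unit_kernel u) = 1 }.

Section fromModule.
Local Notation hdg := (@hdeg S op).
Local Notation E := (fibreC0 R hdg).
Local Notation hrt := (hright op w).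
Local Notation hlt := (hleft op w).
Variable phi : E -> C.
Hypothesis dphi : is_dual phi.
Hypothesis hphi : forall k x,
  ev x (None, k) = phi (acte hrt (delta k) x) - phi (acte hlt (delta k) x).

(** If no [h] satisfied [op h k = k], both actions of [delta k] would annihilate the indicator of
    [(None, k)]: the right action only reads points with first component [Some _], and the left one
    would have to reach [k] as a product [op h k]. But the derivation takes the value 1 there. A
    left identity [u] of the single element [k] is a unit by cancellation, first of [k] in
    [s u k = s k], then of [s] in [s u s = s s]. *)
Lemma hder_inner_unit (k : S) : exists u, is_unit op u.
Proof.
have [u uk] : exists h, op h k = k.
  apply: contrapT => nok.
  pose f (t : option S * S) : C := if t == (None, k) then 1 else 0.
  have [x xf] : exists x : E, forall t, ev x t = f t.
    apply: fc_surj; apply: (@fibre_c0_single _ _ _ k 1) => t.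
      by rewrite /f; case: ifP; rewrite ?normc1 ?normc0.
    by move=> tk; rewrite /f; case: eqP => // te; move: tk; rewrite te.
  have zr : acte hrt (delta k) x = 0.
    apply: fc_ext => -[q h]; rewrite fc0 acte_delta; last exact: hright_graded.
    by rewrite /hright xf /f/= mulr0.
  have zl : acte hlt (delta k) x = 0.
    apply: fc_ext => -[q h]; rewrite fc0 acte_delta; last exact: hleft_graded.
    rewrite /hleft !xf /f/= mulr0 subr0; case: eqP => [[_ e]|_]; last by rewrite mulr0.
    by case: nok; exists h.
  have := hphi k x; rewrite zr zl subrr xf /f eqxx => /eqP.
  by rewrite oner_eq0.
have ru s : op s u = s by apply: (opC k).2; rewrite /= -opA uk.
by exists u => s; split => //; apply: (opC s).1; rewrite opA ru.
Qed.

Variable u : S.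
Hypothesis uU : is_unit op u.
Hypothesis wu : w u = 1.

Let ul s : op u s = s. Proof. by case: (uU s). Qed.
Let ur s : op s u = s. Proof. by case: (uU s). Qed.
Let Oul s : Om u s = 1. Proof. by rewrite /Defs.Omega ul wu mul1r divff// gt_eqF. Qed.
Let Our s : Om s u = 1. Proof. by rewrite /Defs.Omega ur wu mulr1 divff// gt_eqF. Qed.

(* The projection onto the forms vanishing at all (g, u), along the forms that factor
   through the multiplication. *)
Let P y (t : option S * S) : C :=
  y (odflt u t.1, t.2) - (lOm op w t.1 t.2)%:C * y (hdg t, u).

Let PD y z t : P (fun p => y p + z p) t = P y t + P z t.
Proof. by rewrite /P; ring. Qed.

Let PZ c y t : P (fun p => c * y p) t = c * P y t.
Proof. by rewrite /P; ring. Qed.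

Let P_le y t B : (forall p, pdeg p = hdg t -> normc (y p) <= B) -> normc (P y t) <= B + B.
Proof.
move=> yB; apply: le_trans (le_normcD _ _) _; rewrite normcN.
apply: lerD; first by apply: yB; case: t => -[g|] h //=; rewrite /pdeg/= ul.
apply: le_trans (_ : _ <= normc (y (hdg t, u))) _; last by apply: yB; rewrite /pdeg/= ur.
case: t {yB} => -[g|] h /=; first exact: normc_Omega_le.
by rewrite mul1r.
Qed.

Let P_fc y : fibre_c0 pdeg y -> fibre_c0 hdg (P y).
Proof.
move=> [[B yB] y0]; split.
  by exists (B + B) => t; apply: P_le => p _; exact: yB.
move=> e e0; have e3 : 0 < e / 3 by rewrite divr_gt0.
apply: sub_finite_set (y0 _ e3) => j /= [t tj et]; apply: contrapT => hn.
have : normc (P y t) <= e / 3 + e / 3.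
  apply: P_le => p pt; rewrite leNgt; apply/negP => /ltW hp; apply: hn.
  by exists p => //; rewrite pt.
move=> /(le_trans et); lra.
Qed.

(** The witness is [M y = y(u, u) + phi (P y)]. [P] carries [pright] and [pleft] to [hright] and
    [hleft], and [P y] at [(None, k)] is [y(u, k) - y(k, u)]; so the commutator of [phi] supplied by
    [hphi] cancels that of evaluation at [(u, u)]. The normalisation survives because [P] kills
    [unit_kernel u], a form that factors through the multiplication. *)
Lemma hder_inner_virtual_diagonal : exists M, virtual_diagonal u M.
Proof.
have /choice[mk hmk] : forall y, exists x : E, fibre_c0 pdeg y -> forall t, ev x t = P y t.
  move=> y; have [fy|nfy] := pselect (fibre_c0 pdeg y); last by exists 0.
  by have [x hx] := fc_surj (P_fc fy); exists x.
have [p1 p2 _] := dphi; have [K K0 hK] := is_dual_bound dphi.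
have fcD2 y z : fibre_c0 pdeg y -> fibre_c0 pdeg z -> fibre_c0 pdeg (fun p => y p + z p).
  move=> fy fz; have [x hx] := fc_surj fy; have [x' hx'] := fc_surj fz.
  have := fcP (x + x'); congr fibre_c0; apply: funext => p.
  by rewrite fcD hx hx'.
have fcZ2 c y : fibre_c0 pdeg y -> fibre_c0 pdeg (fun p => c * y p).
  move=> fy; have [x hx] := fc_surj fy.
  have := fcP (c *: x); congr fibre_c0; apply: funext => p.
  by rewrite fcZ hx.
exists (fun y => y (u, u) + phi (mk y)); split.
- move=> y z fy fz; rewrite addrACA -p1; congr (_ + phi _); apply: fc_ext => t.
  by rewrite fcD !hmk ?PD//; exact: fcD2.
- move=> c y fy; rewrite mulrDr -p2; congr (_ + phi _); apply: fc_ext => t.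
  by rewrite fcZ !hmk ?PZ//; exact: fcZ2.
- exists (1 + K * 2) => [|y B B0 fy yB]; first by rewrite addr_ge0// mulr_ge0.
  apply: le_trans (le_normcD _ _) _; rewrite mulrDl mul1r lerD//.
  apply: le_trans (hK _) _; rewrite -mulrA ler_wpM2l// supnE.
  rewrite mulr_natl mulr2n; apply: supn_le => [|t]; first by rewrite addr_ge0.
  by rewrite hmk//; apply: P_le.
- move=> k y fy.
  have -> : mk (pright k y) = acte hrt (delta k) (mk y).
    apply: fc_ext => -[q h]; rewrite hmk; last exact: graded_fc pright_graded _ _ fy.
    rewrite acte_delta; last exact: hright_graded.
    rewrite /hright hmk// /P /pright /hdeg/=; case: q => [g|] /=.
      rewrite mulrBr -opA; congr (_ - _).
      rewrite !mulrA; congr (_ * _).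
      by rewrite -!rmorphM [RHS]/(_%:C) [Om k g * _]mulrC -Omega_cocycle// mulrC.
    by rewrite Our !ur !mul1r.
  have -> : mk (pleft k y) = acte hlt (delta k) (mk y).
    apply: fc_ext => -[q h]; rewrite hmk; last exact: graded_fc pleft_graded _ _ fy.
    rewrite acte_delta; last exact: hleft_graded.
    rewrite /hleft !hmk// /P /pleft /hdeg/=; case: q => [g|] /=.
      rewrite Oul ul mul1r -!opA.
      have c1 : (Om h k)%:C * (Om g (op h k))%:C = (Om g h)%:C * (Om (op g h) k)%:C :> C.
        by rewrite -!rmorphM mulrC Omega_cocycle// mulrC.
      by rewrite !mulrBr !mulrA c1; ring.
    by rewrite Oul ul !mul1r; ring.
  have := hphi k (mk y); rewrite hmk// /P /hdeg/= mul1r => h.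
  rewrite /pright /pleft/= Our Oul !ul !mul1r ur.
  apply/eqP; rewrite -subr_eq0; apply/eqP.
  rewrite opprD addrACA -h; ring.
- have fuk : fibre_c0 pdeg (unit_kernel u).
    apply: (@fibre_c0_single _ _ _ u 1) => p; rewrite /unit_kernel.
      case: ifP => _; last by rewrite normc0.
      by rewrite normcR ger0_norm; [exact: Omega_le1|exact/ltW/Omega_gt0].
    by case: eqP.
  have -> : mk (unit_kernel u) = 0.
    apply: fc_ext => -[q h]; rewrite fc0 hmk// /P /unit_kernel /hdeg/=.
    rewrite !ur Our; case: q => [g|] /=; first by case: eqP; rewrite ?mulr1 ?mulr0 subrr.
    by rewrite ul Oul; case: eqP; rewrite ?mulr1 ?mulr0 subrr.
  by rewrite is_dual0// addr0 /unit_kernel/= ul eqxx Oul.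
Qed.

End fromModule.

Lemma connes_amenable_virtual_diagonal (s0 : S) :
  (forall u, is_unit op u -> w u = 1) ->
  connes_amenable (l1alg op w) (c0_predual R S) ->
  exists u, is_unit op u /\ exists M, virtual_diagonal u M.
Proof.
move=> w1 /(connes_amenable_hder opA opC w_gt0 w_sub)[phi [dphi hphi]].
have [u uU] := hder_inner_unit hphi s0.
exists u; split => //; exact: (hder_inner_virtual_diagonal dphi hphi uU (w1 _ uU)).
Qed.

Lemma virtual_diagonal_group u M : is_unit op u -> w u = 1 -> virtual_diagonal u M ->
  is_group op.
Proof.
move=> uU wu vM; exists u; split => // k.
suff [m mk] : exists m, op m k = u.
  exists m; split => //; apply: (opC k).2 => /=; rewrite -opA mk.
  by case: (uU k) => -> ->.
apply: contrapT => nok.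
(* Normalised so that [pright k x] is [unit_kernel u], whereas [pleft k x] vanishes
   unless [k] is invertible. *)
pose x (p : S * S) : C :=
  if `[< exists2 g, p.1 = op k g & op g p.2 = u >] then (w k / (w p.2 * w p.1))%:C else 0.
have uk : op k u = k by case: (uU k).
have fx : fibre_c0 pdeg x.
  apply: (@fibre_c0_single _ _ _ k 1) => -[g' h]; rewrite /x/=.
    case: asboolP => [[g -> gh]|_]; last by rewrite normc0 ler01.
    have den : 0 < w h * w (op k g) by rewrite mulr_gt0.
    rewrite normcR ger0_norm; last by rewrite divr_ge0 ?ltW.
    (* Here [k = op (op k g) h], so submultiplicativity bounds the quotient by 1. *)
    rewrite ler_pdivrMr// mul1r mulrC; apply: le_trans (w_sub _ _).
    by rewrite -opA gh uk.
  by case: asboolP => // -[g -> gh]; case; rewrite /pdeg/= -opA gh uk.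
have wn0 s : w s != 0 by rewrite gt_eqF.
have := vd_comm vM k fx.
have -> : pright k x = unit_kernel u.
  apply: funext => -[g h]; rewrite /pright /x /unit_kernel/=.
  case: asboolP => [[g0 e gh]|ne].
    have {e}ge : g = g0 := (opC k).1 _ _ e.
    rewrite -ge in gh; rewrite gh eqxx -rmorphM; congr (_%:C).
    by rewrite /Defs.Omega gh wu; field; rewrite !wn0.
  by case: eqP => gh; [case: ne; exists g|rewrite mulr0].
rewrite (vd_unit vM).
have -> : pleft k x = fun p => 0 * x p.
  apply: funext => -[g h]; rewrite /pleft /x/= mul0r.
  case: asboolP => [[g0 _ gh]|_]; last by rewrite mulr0.
  by case: nok; exists (op g0 h); rewrite -opA.
by rewrite (vdZ vM 0 fx) mul0r => /eqP; rewrite oner_eq0.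
Qed.

End VirtualDiagonal.

(** * Averaging a derivation against a virtual diagonal *)

Section Averaging.
Variables (R : realType) (S : choiceType) (op : S -> S -> S) (w : S -> R).
Hypothesis opA : associative op.
Hypothesis opC : cancellative op.
Hypothesis w_gt0 : forall s, 0 < w s.
Hypothesis w_sub : forall s t, w (op s t) <= w s * w t.
Local Notation C := R[i].
Local Notation l1 := (@Defs.summable R S).
Local Notation l1norm := (@Defs.l1norm R S).
Local Notation delta := (@Defs.delta R S).
Local Notation conv := (Defs.conv op w).
Local Notation Om := (Defs.Omega op w).
Local Notation A := (l1alg op w).

Let dl1 g : l1 (delta g). Proof. by have [] := delta_l1 R g. Qed.

Lemma mulr2_eq0 (p : C) : p = p + p -> p = 0.
Proof. by move=> h; apply: (addrI p); rewrite addr0 -h. Qed.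

Section derivation.
Variables (E : completeNormedModType C) (la : car A -> E -> E) (ra : E -> car A -> E).
Hypothesis bim : is_bimodule la ra.
Variable D : car A -> E -> C.
Hypothesis derD : is_derivation la ra D.
Hypothesis bndD : bounded_der D.

Lemma bimodule_bound : exists2 k : R, 0 <= k & forall a x, l1 a ->
  rnorm (la a x) <= k * l1norm a * rnorm x /\ rnorm (ra x a) <= k * l1norm a * rnorm x.
Proof.
case: bim => -[_ _ _ _ [k hk]] _; exists `|k| => // a x ha.
have [h1 h2] := hk a x ha.
have le : k * l1norm a * rnorm x <= `|k| * l1norm a * rnorm x.
  by rewrite ler_wpM2r ?rnorm_ge0// ler_wpM2r ?l1norm_ge0// ler_norm.
rewrite !rnormE -rmorphM !lecR in h1 h2.
by split; [exact: le_trans h1 le|exact: le_trans h2 le].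
Qed.

Lemma derivation_bound : exists2 k : R, 0 <= k & forall a x, l1 a ->
  normc (D a x) <= k * l1norm a * rnorm x.
Proof.
case: bndD => k hk; exists `|k| => // a x ha.
have h := hk a x ha; rewrite normC_E rnormE -rmorphM lecR in h.
apply: le_trans h _.
by rewrite ler_wpM2r ?rnorm_ge0// ler_wpM2r ?l1norm_ge0// ler_norm.
Qed.

Let Dadd a x y : l1 a -> D a (x + y) = D a x + D a y.
Proof. by case: derD => h _ _ _ ha; case: (h a ha). Qed.
Let Dscale a c x : l1 a -> D a (c *: x) = c * D a x.
Proof. by case: derD => h _ _ _ ha; case: (h a ha). Qed.

Let raM a b x : l1 a -> l1 b -> ra x (conv a b) = ra (ra x a) b.
Proof. by case: bim => _ h ha hb; case: (h a b x ha hb). Qed.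
Let laM a b x : l1 a -> l1 b -> la (conv a b) x = la a (la b x).
Proof. by case: bim => _ h ha hb; case: (h a b x ha hb). Qed.
Let lra a b x : l1 a -> l1 b -> la a (ra x b) = ra (la a x) b.
Proof. by case: bim => _ h ha hb; case: (h a b x ha hb). Qed.
Let DM a b x : l1 a -> l1 b -> D (conv a b) x = D b (ra x a) + D a (la b x).
Proof. by case: derD => _ _ _ h ha hb; rewrite (h a b ha hb). Qed.

Let convdd g h : conv (delta g) (delta h) = bscale (b := A) (Om g h)%:C (delta (op g h)).
Proof. by rewrite conv_delta. Qed.

Let ra_dd g h x : ra (ra x (delta g)) (delta h) = (Om g h)%:C *: ra x (delta (op g h)).
Proof.
rewrite -(raM x (dl1 g) (dl1 h)) convdd; case: bim => -[_ h2 _ _ _] _.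
by case: (h2 (Om g h)%:C _ x (dl1 (op g h))).
Qed.

Let la_dd g h x : la (delta g) (la (delta h) x) = (Om g h)%:C *: la (delta (op g h)) x.
Proof.
rewrite -(laM x (dl1 g) (dl1 h)) convdd; case: bim => -[_ h2 _ _ _] _.
by case: (h2 (Om g h)%:C _ x (dl1 (op g h))).
Qed.

Let D_dd g h x : (Om g h)%:C * D (delta (op g h)) x =
  D (delta h) (ra x (delta g)) + D (delta g) (la (delta h) x).
Proof.
rewrite -(DM x (dl1 g) (dl1 h)) convdd; case: derD => _ _ h2 _.
by rewrite (h2 _ _ (dl1 (op g h))).
Qed.

Let raD a x y : l1 a -> ra (x + y) a = ra x a + ra y a.
Proof. by case: bim => -[_ _ h _ _] _ ha; case: (h a x y ha). Qed.
Let raZ a c x : l1 a -> ra (c *: x) a = c *: ra x a.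
Proof. by case: bim => -[_ _ _ h _] _ ha; case: (h a c x ha). Qed.
Let laD a x y : l1 a -> la a (x + y) = la a x + la a y.
Proof. by case: bim => -[_ _ h _ _] _ ha; case: (h a x y ha). Qed.
Let laZ a c x : l1 a -> la a (c *: x) = c *: la a x.
Proof. by case: bim => -[_ _ _ h _] _ ha; case: (h a c x ha). Qed.

Lemma dual_actions_lin (psi : E -> C) x : is_dual psi ->
  l1lin (fun a => psi (ra x a) - psi (la a x)).
Proof.
move=> dpsi; have [K K0 hK] := is_dual_bound dpsi; have [k k0 hk] := bimodule_bound.
case: (dpsi) => p1 p2 _; case: bim => -[h1 h2 _ _ _] _.
apply: l1linB; split.
- by move=> a b ha hb; have [_ e] := h1 a b x ha hb; rewrite -p1 -e.
- by move=> c a ha; have [_ e] := h2 c a x ha; rewrite -p2 -e.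
- exists (K * (k * rnorm x)) => a ha; apply: le_trans (hK _) _.
  by rewrite -mulrA ler_wpM2l// mulrAC; have [] := hk a x ha.
- by move=> a b ha hb; have [e _] := h1 a b x ha hb; rewrite -p1 -e.
- by move=> c a ha; have [e _] := h2 c a x ha; rewrite -p2 -e.
- exists (K * (k * rnorm x)) => a ha; apply: le_trans (hK _) _.
  by rewrite -mulrA ler_wpM2l// mulrAC; have [] := hk a x ha.
Qed.

Lemma derivation_lin x : l1lin (D^~ x).
Proof.
have [k k0 hk] := derivation_bound; case: derD => _ h1 h2 _; split.
- by move=> a b ha hb; rewrite (h1 a b ha hb).
- by move=> c a ha; rewrite (h2 c a ha).
- by exists (k * rnorm x) => a ha; rewrite mulrAC; exact: hk.
Qed.

Variables (u : S) (M : (S * S -> C) -> C).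
Hypothesis uU : is_unit op u.
Hypothesis wu : w u = 1.
Hypothesis vM : virtual_diagonal op w u M.

Let ul s : op u s = s. Proof. by case: (uU s). Qed.
Let ur s : op s u = s. Proof. by case: (uU s). Qed.
Let Oul s : Om u s = 1. Proof. by rewrite /Defs.Omega ul wu mul1r divff// gt_eqF. Qed.
Let Our s : Om s u = 1. Proof. by rewrite /Defs.Omega ur wu mulr1 divff// gt_eqF. Qed.

Let kern (j : S) x (p : S * S) : C :=
  if op p.1 p.2 == j then D (delta p.2) (ra x (delta p.1)) else 0.

Let kern_bound : exists2 B : R, 0 <= B & forall j x p, normc (kern j x p) <= B * rnorm x.
Proof.
have [k k0 hk] := bimodule_bound; have [d d0 hd] := derivation_bound.
exists (d * k) => [|j x p]; first exact: mulr_ge0.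
rewrite /kern; case: ifP => _; last by rewrite normc0 mulr_ge0 ?rnorm_ge0// mulr_ge0.
have [_ n1] := delta_l1 R p.1; have [_ n2] := delta_l1 R p.2.
apply: le_trans (hd _ _ (dl1 _)) _; rewrite n2 mulr1 -mulrA ler_wpM2l//.
by have [_] := hk _ x (dl1 p.1); rewrite n1 mulr1.
Qed.

Let kern_fc j x : fibre_c0 (pdeg op) (kern j x).
Proof.
have [B _ hB] := kern_bound.
apply: (@fibre_c0_single _ _ _ _ _ j (B * rnorm x)) => [p|p]; first exact: hB.
by rewrite /kern /pdeg; case: eqP.
Qed.

Let unit_kernel_fc : fibre_c0 (pdeg op) (unit_kernel op w u).
Proof.
apply: (@fibre_c0_single _ _ _ _ _ u 1) => p; rewrite /unit_kernel.
  case: ifP => _; last by rewrite normc0.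
  by rewrite normcR ger0_norm; [exact: Omega_le1|exact/ltW/Omega_gt0].
by rewrite /pdeg; case: eqP.
Qed.

Let avg x : C := M (kern u x).

Let avg_dual : is_dual avg.
Proof.
have [B B0 hB] := kern_bound; have [K K0 hK] := vd_bound vM.
apply: (@is_dual_intro _ _ _ (K * B)).
- move=> x y; rewrite /avg -(vdD vM (kern_fc u x) (kern_fc u y)); congr M.
  apply: funext => p; rewrite /kern; case: ifP => _; last by rewrite addr0.
  by rewrite (raD _ _ (dl1 _)) (Dadd _ _ (dl1 _)).
- move=> c x; rewrite /avg -(vdZ vM c (kern_fc u x)); congr M.
  apply: funext => p; rewrite /kern; case: ifP => _; last by rewrite mulr0.
  by rewrite (raZ _ _ (dl1 _)) (Dscale _ _ (dl1 _)).
- move=> x; rewrite -mulrA; apply: hK; [|exact: kern_fc|exact: hB].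
  by rewrite mulr_ge0 ?rnorm_ge0.
Qed.

(* [vd_comm] moves [delta k] from the variable [g] to the variable [h], where the
   Leibniz rule releases the term in [D (delta k)]. *)
Let avg_comm k x : avg (ra x (delta k)) =
  D (delta k) (ra x (delta u)) + avg (la (delta k) x).
Proof.
have ghk g h : (op (op k g) h == k) = (op g h == u).
  rewrite -opA; apply/eqP/eqP => [e|->]; last by rewrite ur.
  by apply: (opC k).1; rewrite e ur.
have hgk g h : (op g (op h k) == k) = (op g h == u).
  rewrite opA; apply/eqP/eqP => [e|->]; last by rewrite ul.
  by apply: (opC k).2; rewrite /= e ul.
rewrite /avg.
have -> : kern u (ra x (delta k)) = pright op w k (kern k x).
  apply: funext => -[g h]; rewrite /kern /pright/= ghk.
  case: ifP => _; last by rewrite mulr0.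
  by rewrite ra_dd (Dscale _ _ (dl1 _)).
rewrite (vd_comm vM k (kern_fc k x)).
have -> : pleft op w k (kern k x) = fun p =>
    D (delta k) (ra x (delta u)) * unit_kernel op w u p + kern u (la (delta k) x) p.
  apply: funext => -[g h]; rewrite /kern /pleft /unit_kernel/= hgk.
  case: eqP => gh; last by rewrite !mulr0 addr0.
  rewrite D_dd ra_dd gh (Dscale _ _ (dl1 _)) mulrC (lra _ (dl1 _) (dl1 _)).
  by rewrite [D _ _ * _]mulrC.
rewrite (vdD vM (y := fun p => D (delta k) (ra x (delta u)) * unit_kernel op w u p)
  (z := kern u (la (delta k) x))); last exact: kern_fc.
  by rewrite (vdZ vM _ unit_kernel_fc) (vd_unit vM) mulr1.
have [[B hB] _] := unit_kernel_fc.
apply: (@fibre_c0_single _ _ _ _ _ u (normc (D (delta k) (ra x (delta u))) * B)) => p.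
  by rewrite normcM ler_wpM2l ?normc_ge0.
by rewrite /pdeg/unit_kernel; case: eqP => // _ _; rewrite mulr0.
Qed.

Let D_unit x : ra x (delta u) = x -> la (delta u) x = x -> D (delta u) x = 0.
Proof.
move=> hr hl; apply: mulr2_eq0; have := D_dd u u x.
by rewrite Oul mul1r ul hr hl.
Qed.

(** Since [delta u] need not act as the identity on [E], the commutator of [avg] only yields
    [D (delta k) (ra x (delta u))]. By the Leibniz rule for [u] and [k], the missing part of
    [D (delta k) x] is [D (delta u) (la (delta k) x)], which the second term of [psi] supplies; the
    other contribution of that term vanishes by [D_unit]. *)
Lemma virtual_diagonal_inner : is_inner la ra D.
Proof.
pose psi x := avg x - D (delta u) (la (delta u) x).
have [a1 a2 _] := avg_dual; have [Ka Ka0 hKa] := is_dual_bound avg_dual.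
have [kb kb0 hkb] := bimodule_bound; have [kd kd0 hkd] := derivation_bound.
have dpsi : is_dual psi.
  apply: (@is_dual_intro _ _ _ (Ka + kd * kb)).
  - move=> x y; rewrite /psi a1 (laD _ _ (dl1 _)) (Dadd _ _ (dl1 _)); ring.
  - move=> c x; rewrite /psi a2 (laZ _ _ (dl1 _)) (Dscale _ _ (dl1 _)); ring.
  - move=> x; rewrite mulrDl; apply: le_trans (le_normcD _ _) _; rewrite normcN.
    apply: lerD; first exact: hKa.
    have [_ n1] := delta_l1 R u.
    apply: le_trans (hkd _ _ (dl1 _)) _; rewrite n1 mulr1 -mulrA ler_wpM2l//.
    by have [+ _] := hkb _ x (dl1 u); rewrite n1 mulr1.
exists psi; split => // a ha; apply: funext => x; rewrite /dl /dr.
apply: (l1lin_ext (F := fun a => D a x) (G := fun a => psi (ra x a) - psi (la a x))) => //.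
- exact: derivation_lin.
- exact: dual_actions_lin.
move=> k; rewrite /psi avg_comm.
have lau y g : la (delta u) (la (delta g) y) = la (delta g) y.
  by rewrite la_dd Oul ul scale1r.
have rau y g : ra (ra y (delta g)) (delta u) = ra y (delta g).
  by rewrite ra_dd Our ur scale1r.
have -> : D (delta u) (la (delta u) (ra x (delta k))) = 0.
  apply: D_unit; first by rewrite -(lra _ (dl1 _) (dl1 _)) rau.
  exact: lau.
rewrite lau subr0; have := D_dd u k x.
rewrite Oul mul1r ul => ->; ring.
Qed.

End derivation.

Lemma virtual_diagonal_amenable u M : is_unit op u -> w u = 1 ->
  virtual_diagonal op w u M -> amenable A.
Proof.
move=> uU wu vM E la ra bim D derD bndD.
exact: (virtual_diagonal_inner bim derD bndD uU wu vM).
Qed.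

End Averaging.

(** * Uniform boundedness over the complex numbers *)

Section UniformBoundedness.
Variable R : realType.
Local Notation C := R[i].

Section realification.
Variable E : completeNormedModType C.

(** The underlying real Banach space of [E], under a name of its own so that the real scalar
    structure does not compete with the complex one. *)
Definition realify : Type := E.

HB.instance Definition _ := GRing.Zmodule.on realify.

Definition rscale (a : R) (x : realify) : realify := a%:C *: (x : E).

Fact rscaleA a b x : rscale a (rscale b x) = rscale (a * b) x.
Proof. by rewrite /rscale scalerA -rmorphM. Qed.
Fact rscale1 : left_id 1 rscale.
Proof. by move=> x; rewrite /rscale scale1r. Qed.
Fact rscaleDr : right_distributive rscale +%R.
Proof. by move=> a x y; exact: scalerDr. Qed.
Fact rscaleDl x : {morph rscale^~ x : a b / a + b}.
Proof. by move=> a b; rewrite /rscale rmorphD; exact: scalerDl. Qed.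

HB.instance Definition _ := GRing.Zmodule_isLmodule.Build R realify
  rscaleA rscale1 rscaleDr rscaleDl.

Definition renorm (x : realify) : R := rnorm (x : E).

Fact renormD (x y : realify) : renorm (x + y) <= renorm x + renorm y.
Proof. by rewrite -lecR rmorphD; rewrite /renorm /= -!rnormE; exact: ler_normD. Qed.
Fact renormZ (a : R) (x : realify) : renorm (a *: x) = `|a| * renorm x.
Proof.
apply: complexI; rewrite rmorphM /renorm /= -!rnormE.
rewrite [LHS](normrZ (a%:C) (x : E)); congr (_ * _).
by rewrite normC_E normcR.
Qed.
Fact renorm_eq0 (x : realify) : renorm x = 0 -> x = 0.
Proof.
move=> h; apply: (@normr0_eq0 _ E); rewrite rnormE.
by rewrite -[rnorm x]/(renorm x) h.
Qed.

HB.instance Definition _ := Lmodule_isNormed.Build R realify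
  renormD renormZ renorm_eq0.

Lemma realify_normE (x : realify) : `|x| = rnorm (x : E).
Proof. by []. Qed.

Lemma realify_complete (F : set_system realify) : ProperFilter F -> cauchy F -> cvg F.
Proof.
move=> FF /cauchyP Fc.
have cF : cauchy (F : set_system E).
  apply/cauchyP => e e0.
  have e0' : 0 < complex.Re e by move: e0; rewrite ltcE => /andP[].
  have [x Fx] := Fc _ e0'; exists x; apply: filterS Fx => y.
  rewrite -!ball_normE /= realify_normE -ltcR -rnormE.
  by rewrite RRe_real// gtr0_real.
have [l hl] : exists l : E, (F : set_system E) --> l.
  by apply/cvg_ex; exact: cauchy_cvg.
apply/cvg_ex; exists (l : realify); apply/cvgrPdist_le => e e0.
have e0' : (0 : C) < e%:C by rewrite ltcR.
move: hl => /cvgrPdist_le /(_ _ e0') h.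
by apply: filterS h => y /=; rewrite rnormE lecR.
Qed.

HB.instance Definition _ := Uniform_isComplete.Build realify realify_complete.

End realification.

Lemma uniform_boundedness (E : completeNormedModType C) (I : Type) (F : I -> E -> C) :
  (forall i, is_dual (F i)) -> (forall x, exists K, forall i, normc (F i x) <= K) ->
  exists K, forall i x, normc (F i x) <= K * rnorm x.
Proof.
move=> dF bF.
pose G i (x : realify E) : R^o := complex.Re (F i x).
have ReD (a b : C) : complex.Re (a + b) = complex.Re a + complex.Re b by case: a; case: b.
have ReZ (r : R) (a : C) : complex.Re (r%:C * a) = r * complex.Re a.
  by case: a => p q /=; rewrite mul0r subr0.
have [M hM] : exists M, forall i x, rnorm (x : E) <= 1 -> `|G i x| <= M.
  have [] := @Banach_Steinhauss R (realify E) R^o [set g | exists i, g = G i] _ _ 1.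
  - move=> _ [i ->]; have [h1 h2 _] := dF i; split.
      move=> r; have [K K0 hK] := is_dual_bound (dF i); exists (K * r) => x xr.
      apply: le_trans (absRe_le _) _; apply: le_trans (hK x) _.
      by rewrite ler_wpM2l.
    move=> a x y; rewrite /G [F i _](h1 (a%:C *: (x : E)) y) ReD; congr (_ + _).
    by rewrite h2 ReZ.
  - move=> x; have [K hK] := bF x; exists K => _ [i ->].
    by apply: le_trans (absRe_le _) _; exact: hK.
  - move=> M hM; exists M => i x x1; apply: hM => //; by exists i.
exists M => i x; have [h1 h2 _] := dF i.
have M0 : 0 <= M.
  by apply: le_trans (hM i 0 _); rewrite ?normr_ge0// /rnorm normr0/= ler01.
(* A phase makes the value of [F i] real and equal to its modulus, so that a bound for the real
   parts on the unit ball bounds the moduli. *)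
have [u ux u1] := unimodular (F i x).
have rZ (c : C) (y : E) : rnorm (c *: y) = normc c * rnorm y.
  by apply: complexI; rewrite rmorphM /= -!rnormE normrZ normC_E.
have [x0|xn0] := eqVneq (rnorm x) 0.
  have -> : x = 0 by apply/eqP; rewrite -normr_eq0 rnormE x0.
  by rewrite is_dual0// normc0 mulr_ge0 ?rnorm_ge0.
have xp : 0 < rnorm x by rewrite lt0r xn0 rnorm_ge0.
have := hM i ((u * ((rnorm x)^-1)%:C) *: x) _.
rewrite rZ normcM normcR ger0_norm ?invr_ge0 ?rnorm_ge0// -mulrA mulVf// mulr1.
move=> /(_ u1); rewrite /G h2 mulrAC ux -rmorphM/=.
by rewrite normrM !ger0_norm ?normc_ge0 ?invr_ge0 ?rnorm_ge0// ler_pdivrMr.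
Qed.

End UniformBoundedness.

(** * From amenability to Connes-amenability along a weak*-dense image *)

Section DenseImage.
Variables (R : realType) (S : choiceType) (op : S -> S -> S) (w : S -> R).
Local Notation C := R[i].
Local Notation l1 := (@Defs.summable R S).
Local Notation l1norm := (@Defs.l1norm R S).
Local Notation conv := (Defs.conv op w).
Local Notation A := (l1alg op w).
Variables (B : BAlg R) (P : set (car B -> C)) (iota : (S -> C) -> car B).
Hypothesis iota_mem : forall a, l1 a -> Defs.mem (iota a).
Hypothesis iotaD : forall a b, l1 a -> l1 b ->
  iota (fun g => a g + b g) = badd (iota a) (iota b).
Hypothesis iotaZ : forall c a, l1 a -> iota (fun g => c * a g) = bscale c (iota a).
Hypothesis iotaM : forall a b, l1 a -> l1 b -> iota (conv a b) = bmul (iota a) (iota b).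
Hypothesis iota_norm : exists k, forall a, l1 a ->
  0 <= bnorm (iota a) /\ bnorm (iota a) <= k * l1norm a.
Hypothesis P_iota : forall p, P p -> l1lin (fun a => p (iota a)).
(** Weak* density in an exact form: finitely many predual functionals can be matched, not merely
    approximated. For the bidual this is [bidual_dense]. *)
Hypothesis iota_dense : forall (I : finType) (p : I -> car B -> C), (forall i, P (p i)) ->
  forall b, Defs.mem b -> exists2 a, l1 a & forall i, p i (iota a) = p i b.

Let iota_bound (k : R) : exists2 k' : R, 0 <= k' & forall a, l1 a ->
  k * bnorm (iota a) <= k' * l1norm a.
Proof.
have [k1 hk1] := iota_norm; exists (`|k| * `|k1|) => [|a ha]; first exact: mulr_ge0.
have [b0 b1] := hk1 a ha.
apply: (@le_trans _ _ (`|k| * bnorm (iota a))); first by rewrite ler_wpM2r// ler_norm.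
rewrite -mulrA ler_wpM2l//; apply: le_trans b1 _.
by rewrite ler_wpM2r ?l1norm_ge0// ler_norm.
Qed.

Variables (E : completeNormedModType C) (la : car B -> E -> E) (ra : E -> car B -> E).
Hypothesis bim : is_bimodule la ra.

Lemma iota_bimodule :
  is_bimodule (B := A) (fun a x => la (iota a) x) (fun x a => ra x (iota a)).
Proof.
case: bim => -[h1 h2 h3 h4 [k h5]] h6; split; first split.
- by move=> a b x ha hb; rewrite /= iotaD//; apply: h1; exact: iota_mem.
- by move=> c a x ha; rewrite /= iotaZ//; apply: h2; exact: iota_mem.
- by move=> a x y ha; apply: h3; exact: iota_mem.
- by move=> a c x ha; apply: h4; exact: iota_mem.
- have [k' k'0 hk'] := iota_bound k; exists k' => a x ha.
  have [e1 e2] := h5 _ x (iota_mem ha).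
  have le : (k * bnorm (iota a))%:C * `|x| <= (k' * l1norm a)%:C * `|x|.
    by rewrite ler_wpM2r// lecR; exact: hk'.
  by split; [exact: le_trans e1 le|exact: le_trans e2 le].
- move=> a b x ha hb; rewrite /= iotaM//.
  by apply: h6; exact: iota_mem.
Qed.

Variable D : car B -> E -> C.
Hypothesis derD : is_derivation la ra D.
Hypothesis wcD : wcont P D.

Lemma iota_derivation :
  is_derivation (B := A) (fun a x => la (iota a) x) (fun x a => ra x (iota a))
    (fun a => D (iota a)).
Proof.
case: derD => h1 h2 h3 h4; split.
- by move=> a ha; apply: h1; exact: iota_mem.
- by move=> a b ha hb; rewrite /= iotaD//; apply: h2; exact: iota_mem.
- by move=> c a ha; rewrite /= iotaZ//; apply: h3; exact: iota_mem.
- by move=> a b ha hb; rewrite /= iotaM//; apply: h4; exact: iota_mem.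
Qed.

Let D_scale c a x : l1 a -> D (iota (fun g => c * a g)) x = c * D (iota a) x.
Proof.
by move=> ha; case: derD => _ _ h _; rewrite iotaZ// (h _ _ (iota_mem ha)).
Qed.

Let D_zero x : D (iota (fun=> 0)) x = 0.
Proof.
apply: etrans (etrans (D_scale 0 x (l1_0 R S)) (mul0r _)).
by congr (D (iota _) x); apply: funext => g; rewrite mul0r.
Qed.

(** Weak* continuity at 0 bounds [D] by 1 on a basic neighbourhood of 0. Its finitely many
    functionals are norm-bounded on the image of [l^1], so it absorbs the image of the unit ball. *)
Lemma iota_pointwise_bounded x : exists K, forall a, l1 a -> l1norm a <= 1 ->
  normc (D (iota a) x) <= K.
Proof.
have [m [ps [d [d0 hps hD]]]] :=
  wcD (iota_mem (l1_0 R S)) (fun _ : 'I_1 => x) (ltr01 : 0 < 1 :> R).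
have /choice[k hk] : forall i, exists k, 0 <= k /\
    forall a, l1 a -> normc (ps i (iota a)) <= k * l1norm a.
  move=> i; have [_ _ [k hk]] := P_iota (hps i); exists `|k|; split => // a ha.
  by apply: le_trans (hk a ha) _; rewrite ler_wpM2r ?l1norm_ge0// ler_norm.
pose K := \sum_i k i + 1.
have K0 : 0 < K by rewrite ltr_wpDl// sumr_ge0// => i _; case: (hk i).
have kK i : k i < K.
  rewrite /K (bigD1 i)//= -addrA ltrDl ltr_wpDl// sumr_ge0// => j _.
  by case: (hk j).
(* Every [k i] is strictly below [K], so scaling the unit ball by [c] brings all the functionals
   strictly below [d]. *)
pose c : R := d / K; have c0 : 0 < c by rewrite divr_gt0.
exists c^-1 => a ha a1.
have hca := l1Z (c%:C) ha.
have := hD _ (iota_mem hca) _ ord0.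
rewrite D_zero D_scale// subr0 normC_E ltcR normcM normcR gtr0_norm// => h.
rewrite -[_^-1]mul1r ler_pdivlMr// mulrC; apply/ltW/h => i.
have [_ p2 _] := P_iota (hps i); rewrite (l1lin0 (P_iota (hps i))) subr0 p2//.
rewrite normC_E ltcR normcM normcR gtr0_norm//.
apply: (@le_lt_trans _ _ (c * k i)).
  rewrite ler_wpM2l ?(ltW c0)//; apply: le_trans ((hk i).2 _ ha) _.
  by rewrite ler_piMr// (hk i).1.
by rewrite /c mulrAC ltr_pdivrMr// ltr_pM2l.
Qed.

Lemma iota_bounded_der : bounded_der (B := A) (fun a => D (iota a)).
Proof.
have dF (i : {a : S -> C | l1 a /\ l1norm a <= 1}) : is_dual (D (iota (sval i))).
  by case: i => a [ha _] /=; case: derD => h _ _ _; apply: h; exact: iota_mem.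
have bF x : exists K, forall i : {a : S -> C | l1 a /\ l1norm a <= 1},
    normc (D (iota (sval i)) x) <= K.
  have [K hK] := iota_pointwise_bounded x; exists K => -[a [ha a1]] /=.
  exact: hK.
have [K hK] := uniform_boundedness dF bF.
exists K => a x ha.
rewrite normC_E rnormE -rmorphM lecR /=.
have [a0|an0] := eqVneq (l1norm a) 0.
  have -> : a = fun=> 0.
    apply: funext => g; apply/eq0_normc/eqP; rewrite eq_le normc_ge0 andbT.
    by rewrite -a0; exact: l1norm_ub.
  rewrite D_zero normc0 (_ : l1norm _ = 0) ?mulr0 ?mul0r//.
  by rewrite /Defs.l1norm esum1// => g _; rewrite [Normc.normc _]normc0.
have ap : 0 < l1norm a by rewrite lt0r an0 l1norm_ge0.
have hb := l1Z ((l1norm a)^-1%:C) ha.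
have nb : l1norm (fun g => (l1norm a)^-1%:C * a g) <= 1.
  by rewrite l1normZ// normcR ger0_norm ?invr_ge0 ?l1norm_ge0// mulVf.
have := hK (exist _ _ (conj hb nb)) x; rewrite /= D_scale// normcM normcR.
by rewrite ger0_norm ?invr_ge0 ?l1norm_ge0// ler_pdivrMl// mulrCA mulrA.
Qed.

Lemma dense_inner (phi : E -> C) :
  wcont P (fun a => dl ra a phi) -> wcont P (fun a => dr la phi a) ->
  (forall a, l1 a -> D (iota a) = fun x => dl ra (iota a) phi x - dr la phi (iota a) x) ->
  forall b, Defs.mem b -> D b = fun x => dl ra b phi x - dr la phi b x.
Proof.
move=> wl wr hphi b hb; apply: funext => x.
apply/eqP; rewrite -subr_eq0; apply/eqP/eq0_normc/eqP; rewrite eq_le normc_ge0 andbT.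
apply/ler_addgt0Pl => e e0; rewrite addr0.
have e3 : 0 < e / 3 by rewrite divr_gt0.
have [m1 [p1 [d1 [d10 h1 w1]]]] := wcD hb (fun _ : 'I_1 => x) e3.
have [m2 [p2 [d2 [d20 h2 w2]]]] := wl _ hb _ (fun _ : 'I_1 => x) _ e3.
have [m3 [p3 [d3 [d30 h3 w3]]]] := wr _ hb _ (fun _ : 'I_1 => x) _ e3.
(* The functionals controlling [D] and the two orbit maps are merged into one family, so that a
   single [a] serves all three estimates. *)
pose p (i : ('I_m1 + ('I_m2 + 'I_m3))%type) := match i with
  | inl j => p1 j | inr (inl j) => p2 j | inr (inr j) => p3 j end.
have [|a ha hp] := @iota_dense _ p _ b hb; first by case=> [i|[i|i]] /=.
have v1 : normc (D (iota a) x - D b x) < e / 3.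
  have := w1 _ (iota_mem ha) _ ord0; rewrite normC_E ltcR; apply => i.
  by rewrite (hp (inl i) : p1 i (iota a) = p1 i b) subrr normr0 ltcR.
have v2 : normc (dl ra (iota a) phi x - dl ra b phi x) < e / 3.
  have := w2 _ (iota_mem ha) _ ord0; rewrite normC_E ltcR; apply => i.
  by rewrite (hp (inr (inl i)) : p2 i (iota a) = p2 i b) subrr normr0 ltcR.
have v3 : normc (dr la phi (iota a) x - dr la phi b x) < e / 3.
  have := w3 _ (iota_mem ha) _ ord0; rewrite normC_E ltcR; apply => i.
  by rewrite (hp (inr (inr i)) : p3 i (iota a) = p3 i b) subrr normr0 ltcR.
rewrite hphi// in v1.
set y1 := dl ra (iota a) phi x in v1 v2; set y2 := dr la phi (iota a) x in v1 v3.
set z1 := dl ra b phi x in v2 *; set z2 := dr la phi b x in v3 *.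
have -> : D b x - (z1 - z2) = - (y1 - y2 - D b x) + ((y1 - z1) + - (y2 - z2)) by ring.
apply: le_trans (le_normcD _ _) _; rewrite normcN.
have := le_normcD (y1 - z1) (- (y2 - z2)); rewrite normcN; lra.
Qed.

End DenseImage.

Lemma dense_connes_amenable (R : realType) (S : choiceType) (op : S -> S -> S) (w : S -> R)
    (B : BAlg R) (P : set (car B -> R[i])) (iota : (S -> R[i]) -> car B) :
  let l1 := @Defs.summable R S in
  (forall a, l1 a -> Defs.mem (iota a)) ->
  (forall a b, l1 a -> l1 b -> iota (fun g => a g + b g) = badd (iota a) (iota b)) ->
  (forall c a, l1 a -> iota (fun g => c * a g) = bscale c (iota a)) ->
  (forall a b, l1 a -> l1 b -> iota (Defs.conv op w a b) = bmul (iota a) (iota b)) ->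
  (exists k, forall a, l1 a ->
    0 <= bnorm (iota a) /\ bnorm (iota a) <= k * Defs.l1norm a) ->
  (forall p, P p -> l1lin (fun a => p (iota a))) ->
  (forall (I : finType) (p : I -> car B -> R[i]), (forall i, P (p i)) ->
    forall b, Defs.mem b -> exists2 a, l1 a & forall i, p i (iota a) = p i b) ->
  amenable (l1alg op w) -> connes_amenable B P.
Proof.
move=> l1 i_mem iD iZ iM i_norm P_lin dense am E la ra bim wc D derD wcD.
have [phi [dphi hphi]] := am E _ _ (iota_bimodule i_mem iD iZ iM i_norm bim) _
  (iota_derivation i_mem iD iZ iM derD)
  (iota_bounded_der op w i_mem iZ P_lin derD wcD).
have [w1 w2] := wc phi dphi.
exists phi; split => //.
exact: (dense_inner i_mem dense wcD w1 w2).
Qed.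

(** * The bidual *)

Section Bidual.
Variables (R : realType) (S : choiceType).
Local Notation C := R[i].
Local Notation l1 := (@Defs.summable R S).
Local Notation l1norm := (@Defs.l1norm R S).
Local Notation delta := (@Defs.delta R S).
Local Notation bounded := (@Defs.bounded R S).
Local Notation pair := (@Defs.pair R S).
Implicit Types (Phi Psi : (S -> C) -> C) (mu : S -> C).

Lemma boundedD mu nu : bounded mu -> bounded nu -> bounded (fun g => mu g + nu g).
Proof.
move=> [k hk] [k' hk']; exists (k + k') => g.
by apply: le_trans (le_normcD _ _) _; exact: lerD.
Qed.

Lemma boundedZ c mu : bounded mu -> bounded (fun g => c * mu g).
Proof.
by move=> [k hk]; exists (normc c * k) => g; rewrite normcM ler_wpM2l ?normc_ge0.
Qed.

Lemma bounded0 : bounded (fun=> 0).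
Proof. by exists 0 => g; rewrite [Normc.normc _]normc0. Qed.

Lemma delta_bounded g : bounded (delta g).
Proof. by exists 1; exact: delta_le1. Qed.

Lemma pair_deltal g x : l1 x -> pair (delta g) x = x g.
Proof.
move=> hx; rewrite /Defs.pair (@sumC1 _ _ _ _ g)//.
  by rewrite /Defs.delta eqxx mul1r.
by move=> i _ /negbTE ig; rewrite /Defs.delta ig mul0r.
Qed.

Lemma bounded_sum (I : Type) (s : seq I) (c : I -> C) (mu : I -> S -> C) :
  (forall i, bounded (mu i)) -> bounded (fun g => \sum_(i <- s) c i * mu i g).
Proof.
move=> bmu; elim: s => [|i s IH].
  rewrite (_ : (fun g => _) = fun=> 0); first exact: bounded0.
  by apply: funext => g; rewrite big_nil.
rewrite (_ : (fun g => _) = fun g => c i * mu i g + \sum_(j <- s) c j * mu j g).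
  by apply: boundedD => //; exact: boundedZ.
by apply: funext => g; rewrite big_cons.
Qed.

Lemma bidual0 Phi : bidual_mem Phi -> Phi (fun=> 0) = 0.
Proof.
move=> [_ _ hZ _]; rewrite -[RHS](mul0r (Phi (fun=> 0))) -(hZ 0 _ bounded0).
by congr Phi; apply: funext => g; rewrite mul0r.
Qed.

Lemma bidual_sum Phi (I : Type) (s : seq I) (c : I -> C) (mu : I -> S -> C) :
  bidual_mem Phi -> (forall i, bounded (mu i)) ->
  Phi (fun g => \sum_(i <- s) c i * mu i g) = \sum_(i <- s) c i * Phi (mu i).
Proof.
move=> mPhi bmu; have [_ hD hZ _] := mPhi; elim: s => [|i s IH].
  rewrite big_nil -[RHS](bidual0 mPhi); congr Phi.
  by apply: funext => g; rewrite big_nil.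
rewrite big_cons -IH -(hZ _ _ (bmu i)).
rewrite -(hD _ _ (boundedZ _ (bmu i)) (bounded_sum _ _ bmu)).
by congr Phi; apply: funext => g; rewrite big_cons.
Qed.

Lemma l1lin_sum F (I : Type) (s : seq I) (c : I -> C) (gs : I -> S) : l1lin F ->
  l1 (fun g => \sum_(i <- s) c i * delta (gs i) g) /\
  F (fun g => \sum_(i <- s) c i * delta (gs i) g) = \sum_(i <- s) c i * F (delta (gs i)).
Proof.
move=> lF; have [hD hZ _] := lF; elim: s => [|i s [IH1 IH2]].
  have -> : (fun g => \sum_(i <- [::]) c i * delta (gs i) g) = fun=> 0.
    by apply: funext => g; rewrite big_nil.
  by rewrite big_nil l1lin0//; split => //; exact: l1_0.
have [hd _] := delta_l1 R (gs i).
have -> : (fun g => \sum_(j <- i :: s) c j * delta (gs j) g) =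
    fun g => c i * delta (gs i) g + \sum_(j <- s) c j * delta (gs j) g.
  by apply: funext => g; rewrite big_cons.
split; first by apply: l1D => //; exact: l1Z.
by rewrite big_cons (hD _ _ (l1Z _ hd) IH1) IH2 (hZ _ _ hd).
Qed.

(** Linear algebra in dimension [n]. Points [gs] for which the matrix of values [mu i (gs k)] has
    maximal rank make its row space contain every row [rw g], since a further point would otherwise
    raise the rank. The row of the values [Phi (mu i)] lies there too, and its coordinates are the
    coefficients of a finitely supported [a]. No control of the norm of [a] is sought. *)
Lemma bidual_dense n (mu : 'I_n -> S -> C) Phi : (forall i, bounded (mu i)) ->
  bidual_mem Phi -> exists2 a, l1 a & forall i, pair (mu i) a = Phi (mu i).
Proof.
move=> bmu mPhi; pose rw g : 'rV[C]_n := \row_i mu i g.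
pose mx m (gs : 'I_m -> S) : 'M[C]_(m, n) := \matrix_(k, i) mu i (gs k).
have row_mx m (gs : 'I_m -> S) k : row k (mx m gs) = rw (gs k).
  by apply/rowP => i; rewrite !mxE.
have [m [gs hgs]] : exists m (gs : 'I_m -> S), forall g, (rw g <= mx m gs)%MS.
  pose Q r := `[< exists m (gs : 'I_m -> S), \rank (mx m gs) = r >].
  have exQ : exists r, Q r.
    have gs0 : 'I_0 -> S by case.
    by exists (\rank (mx 0 gs0)); apply/asboolP; exists 0%N, gs0.
  have Qn r : Q r -> (r <= n)%N by move=> /asboolP[m [gs <-]]; exact: rank_leq_col.
  case: (ex_maxnP exQ Qn) => r /asboolP[m [gs rgs]] rmax.
  exists m, gs => g; apply: contrapT => hg.
  pose gs' (k : 'I_m.+1) := if unlift ord0 k is Some j then gs j else g.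
  have le1 : (mx m gs <= mx m.+1 gs')%MS.
    apply/row_subP => k; rewrite row_mx.
    have -> : gs k = gs' (lift ord0 k) by rewrite /gs' liftK.
    by rewrite -row_mx row_sub.
  have le2 : (rw g <= mx m.+1 gs')%MS.
    have -> : g = gs' ord0 by rewrite /gs' unlift_none.
    by rewrite -row_mx row_sub.
  have [h1 h2] := mxrank_leqif_sup le1.
  have : (\rank (mx m.+1 gs') <= r)%N by apply: rmax; apply/asboolP; exists m.+1, gs'.
  rewrite -rgs => h3; move: h2; rewrite eqn_leq h1 h3/= => /esym h4.
  by apply: hg; exact: submx_trans le2 h4.
pose v : 'rV[C]_n := \row_i Phi (mu i).
have : (v <= mx m gs)%MS.
  (* A column annihilating the matrix annihilates every [rw g]; the corresponding combination of the
     [mu i] is therefore identically 0, and [Phi] sends it to 0. *)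
  rewrite submxE; apply/eqP/rowP => j; rewrite !mxE.
  under eq_bigr do rewrite mxE mulrC.
  rewrite -(bidual_sum _ _ mPhi bmu).
  rewrite -[RHS](bidual0 mPhi); congr Phi; apply: funext => g.
  have := hgs g; rewrite submxE => /eqP/rowP/(_ j).
  rewrite !mxE => h; rewrite -[RHS]h; apply: eq_bigr => i _.
  have -> : rw g 0 i = mu i g by rewrite mxE.
  exact: mulrC.
move=> /submxP[d vd].
pose F i a : C := pair (mu i) a.
have hF i : l1lin (F i) by exact: l1lin_pair.
exists (fun g => \sum_k d 0 k * delta (gs k) g).
  have l0 : l1lin (fun _ : S -> C => 0).
    by split=> [*|*|]; rewrite ?addr0 ?mulr0//; exists 0 => a _; rewrite mul0r [Normc.normc _]normc0.
  by have [] := l1lin_sum (index_enum 'I_m) (d 0) gs l0.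
move=> i; have [_ sumE] := l1lin_sum (index_enum 'I_m) (d 0) gs (hF i).
apply: (etrans sumE).
have := congr1 (fun M : 'rV[C]_n => M 0 i) vd; rewrite !mxE => ->.
by apply: eq_bigr => k _; rewrite mxE /F pair_delta.
Qed.

Definition bikernel (m : S -> S -> C) (a b : S -> C) : C :=
  pair (fun g => pair (m g) b) a.

Section bikernel.
Variables (m : S -> S -> C) (k : R).
Hypothesis mk : forall g h, normc (m g h) <= k.

Lemma bikernel_inner_le b g : l1 b -> normc (pair (m g) b) <= 2 * (k * l1norm b).
Proof. by move=> hb; apply: pair_le. Qed.

Lemma bikernel_linl b : l1 b -> l1lin (fun a => bikernel m a b).
Proof. by move=> hb; apply: l1lin_pair; eexists => g; exact: bikernel_inner_le. Qed.

Lemma bikernel_linr a : l1 a -> l1lin (fun b => bikernel m a b).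
Proof.
move=> ha; have bnd b : l1 b -> bounded (fun g => pair (m g) b).
  by move=> hb; eexists => g; exact: bikernel_inner_le.
split.
- move=> b b' hb hb'; rewrite /bikernel -pairDl//; [|exact: bnd..].
  by congr (pair _ a); apply: funext => g; exact: (pairDr (mk g)).
- move=> c b hb; rewrite /bikernel -pairZl//; last exact: bnd.
  by congr (pair _ a); apply: funext => g; exact: (pairZr (mk g)).
- exists (4 * k * l1norm a) => b hb.
  have h : forall g, normc (pair (m g) b) <= 2 * (k * l1norm b).
    by move=> g; exact: bikernel_inner_le.
  by apply: le_trans (pair_le h ha) _; lra.
Qed.

Lemma bikernel_delta g h : bikernel m (delta g) (delta h) = m g h.
Proof. by rewrite /bikernel !pair_delta. Qed.

End bikernel.

(** The canonical embedding; the value 0 off [l^infty] is the normalisation built into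
    [bidual_mem]. *)
Definition bidual_emb (a : S -> C) : (S -> C) -> C :=
  fun mu => if `[< bounded mu >] then pair mu a else 0.

Lemma bidual_embE a mu : bounded mu -> bidual_emb a mu = pair mu a.
Proof. by move=> h; rewrite /bidual_emb asboolT. Qed.

Lemma bidual_emb_mem a : l1 a -> bidual_mem (bidual_emb a).
Proof.
move=> ha; split.
- by move=> mu h; rewrite /bidual_emb asboolF.
- by move=> mu nu h h'; rewrite !bidual_embE ?pairDl//; exact: boundedD.
- by move=> c mu h; rewrite !bidual_embE ?pairZl//; exact: boundedZ.
- exists (2 * l1norm a) => mu k' h; rewrite bidual_embE; last by exists k'.
  by apply: le_trans (pair_le h ha) _; rewrite -mulrA [k' * _]mulrC.
Qed.

Lemma bidual_norm_ub Phi mu : bidual_mem Phi -> (forall g, normc (mu g) <= 1) ->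
  normc (Phi mu) <= bidual_norm Phi.
Proof.
move=> [_ _ _ [k hk]] h; apply: ub_le_sup; last by exists mu.
by exists (k * 1) => _ [nu hnu <-]; exact: hk.
Qed.

Lemma bidual_emb_norm a : l1 a ->
  0 <= bidual_norm (bidual_emb a) /\ bidual_norm (bidual_emb a) <= 2 * l1norm a.
Proof.
move=> ha; have z : forall g : S, normc ((fun=> 0) g : C) <= 1.
  by move=> g; rewrite [Normc.normc _]normc0.
split.
  by apply: le_trans (normc_ge0 _) (bidual_norm_ub (bidual_emb_mem ha) z).
apply: ge_sup; first by exists (normc (bidual_emb a (fun=> 0))), (fun=> 0).
move=> _ [mu hmu <-]; rewrite bidual_embE; last by exists 1.
by apply: le_trans (pair_le hmu ha) _; rewrite mul1r.
Qed.

(** Restriction of a functional to [c_0(S)], read as an element of [l^1(S)] through its values on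
    unit vectors. *)
Definition bidual_restr Phi : S -> C := fun g => Phi (delta g).

(** Phases align the values of [Phi] on finitely many unit vectors. The resulting combination has
    sup norm at most 1 because their supports are disjoint. *)
Lemma bidual_restr_l1 Phi : bidual_mem Phi ->
  l1 (bidual_restr Phi) /\ l1norm (bidual_restr Phi) <= bidual_norm Phi.
Proof.
move=> mPhi.
have key (s : seq S) : uniq s -> (forall i, i \in s -> [set: S] i) ->
    \sum_(i <- s) normc (bidual_restr Phi i) <= bidual_norm Phi.
  move=> us _; have /choice[th hth] : forall g, exists u : C,
      u * bidual_restr Phi g = (normc (bidual_restr Phi g))%:C /\ normc u <= 1.
    by move=> g; have [u ? ?] := unimodular (bidual_restr Phi g); exists u.
  have -> : \sum_(i <- s) normc (bidual_restr Phi i) =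
      normc (Phi (fun g => \sum_(i <- s) th i * delta i g)).
    rewrite (bidual_sum _ _ mPhi (@delta_bounded)) (eq_bigr _ (fun i _ => (hth i).1)).
    rewrite -rmorph_sum normcR ger0_norm// sumr_ge0// => i _; exact: normc_ge0.
  apply: bidual_norm_ub => // g.
  have [gs|gs] := boolP (g \in s).
    rewrite (bigD1_seq g)//= big1 => [|i ig].
      by rewrite addr0 /Defs.delta eqxx mulr1 (hth g).2.
    by rewrite /Defs.delta eq_sym (negbTE ig) mulr0.
  rewrite big_seq big1 ?[Normc.normc _]normc0// => i si; rewrite /Defs.delta.
  by case: eqP => [e|_]; [move: gs; rewrite e si|rewrite mulr0].
split; first exact: has_nsumP key.
by apply: nsum_le key => i; exact: normc_ge0.
Qed.

(** Both sides are bounded functionals of [f] that agree on unit vectors, and finitely supported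
    functions are dense in [c_0]. *)
Lemma bidual_emb_restr Phi f : bidual_mem Phi -> Defs.c0 f ->
  Phi f = pair f (bidual_restr Phi).
Proof.
move=> mPhi f0; have bf := c0_bounded f0.
have [lPhi _] := bidual_restr_l1 mPhi.
rewrite -(bidual_embE _ bf).
set Psi := bidual_emb _; have mPsi : bidual_mem Psi := bidual_emb_mem lPhi.
have agree g : Phi (delta g) = Psi (delta g).
  by rewrite /Psi bidual_embE ?pair_deltal//; exact: delta_bounded.
apply/eqP; rewrite -subr_eq0; apply/eqP/eq0_normc/eqP; rewrite eq_le normc_ge0 andbT.
apply/ler_addgt0Pl => e e0; rewrite addr0.
case: (mPhi) => _ D1 _ [k1 hk1]; case: (mPsi) => _ D2 _ [k2 hk2].
have kp : 0 < `|k1| + `|k2| + 1 by rewrite ltr_wpDl// addr_ge0.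
pose d := e / (`|k1| + `|k2| + 1); have d0 : 0 < d by rewrite divr_gt0.
have fin := f0 d d0; set A := [set g | d <= normc (f g)] in fin.
pose J := finmap.enum_fset (fset_set A).
have JE j : (j \in J) = (j \in A) by exact: in_fset_set.
have uJ : uniq J by exact: finmap.fset_uniq.
pose p g : C := \sum_(i <- J) f i * delta i g.
have bp : bounded p by apply: bounded_sum => i; exact: delta_bounded.
pose r g : C := f g + -1 * p g.
have br : bounded r by apply: boundedD => //; exact: boundedZ.
have fE : f = fun g => p g + r g by apply: funext => g; rewrite /r mulN1r addrC subrK.
have pE : Phi p = Psi p.
  rewrite (bidual_sum _ _ mPhi (@delta_bounded)) (bidual_sum _ _ mPsi (@delta_bounded)).
  by apply: eq_bigr => i _; rewrite agree.
have rd g : normc (r g) <= d.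
  rewrite /r mulN1r; have [gJ|gJ] := boolP (g \in J).
    rewrite /p (bigD1_seq g)//= big1 => [|i ig].
      by rewrite addr0 /Defs.delta eqxx mulr1 subrr normc0 ltW.
    by rewrite /Defs.delta eq_sym (negbTE ig) mulr0.
  rewrite /p big_seq big1 => [|i iJ].
    by rewrite subr0; move: gJ; rewrite JE notin_setE /A/= => /negP; rewrite -ltNge => /ltW.
  by rewrite /Defs.delta; case: eqP => [ge|_]; [move: gJ; rewrite ge iJ|rewrite mulr0].
rewrite fE D1// D2// pE opprD addrACA subrr add0r.
apply: le_trans (le_normcD _ _) _; rewrite normcN.
apply: (@le_trans _ _ (`|k1| * d + `|k2| * d)).
  apply: lerD.
    by apply: le_trans (hk1 _ _ rd) _; rewrite ler_wpM2r ?ler_norm// ltW.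
  by apply: le_trans (hk2 _ _ rd) _; rewrite ler_wpM2r ?ler_norm// ltW.
rewrite -mulrDl; apply: (@le_trans _ _ ((`|k1| + `|k2| + 1) * d)).
  by rewrite ler_wpM2r ?(ltW d0)// lerDl.
by rewrite /d mulrC divfK// gt_eqF.
Qed.

Section product.
Variables (op : S -> S -> S) (w : S -> R).
Hypothesis opC : cancellative op.
Hypothesis w_gt0 : forall s, 0 < w s.
Hypothesis w_sub : forall s t, w (op s t) <= w s * w t.
Local Notation conv := (Defs.conv op w).

Lemma dotr_kernel_le mu k g h : 0 <= k -> (forall g, normc (mu g) <= k) ->
  normc (dotr op w mu (delta g) h) <= 4 * k.
Proof.
move=> k0 hk; have [hg ng] := delta_l1 R g; have [hh nh] := delta_l1 R h.
have [hc nc] := conv_l1_norm w_gt0 w_sub hg hh.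
apply: le_trans (pair_le hk hc) _; move: nc; rewrite ng nh => nc.
by have := ler_wpM2l k0 nc; lra.
Qed.

(** The product is tested against [mu] one variable at a time, in the order of the first Arens
    product. *)
Lemma dotr_bilin mu a b : bounded mu -> l1 a -> l1 b ->
  pair mu (conv a b) = bikernel (fun g => dotr op w mu (delta g)) a b.
Proof.
move=> [k0 hk0]; have [k k_ge0 hk] : exists2 k : R, 0 <= k & forall g, normc (mu g) <= k.
  by exists `|k0| => // g; apply: le_trans (hk0 g) _; exact: ler_norm.
have mk g h := dotr_kernel_le g h k_ge0 hk.
have lmu : l1lin (pair mu) by apply: l1lin_pair; exists k.
apply: (l1bilin_ext (F := fun a b => pair mu (conv a b))
  (G := bikernel (fun g => dotr op w mu (delta g)))).
- by move=> a' ha'; exact: (l1lin_convr w_gt0 w_sub lmu).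
- by move=> b' hb'; exact: (l1lin_convl w_gt0 w_sub lmu).
- by move=> a' ha'; exact: (bikernel_linr mk).
- by move=> b' hb'; exact: (bikernel_linl mk).
by move=> g h; rewrite bikernel_delta.
Qed.

Lemma bidual_emb_conv a b : l1 a -> l1 b ->
  bidual_emb (conv a b) = arens1 op w (bidual_emb a) (bidual_emb b).
Proof.
move=> ha hb; apply: funext => mu; rewrite /arens1 {1}/bidual_emb.
case: asboolP => // bmu; rewrite dotr_bilin//.
case: bmu => k0 hk0; have [k k_ge0 hk] : exists2 k : R, 0 <= k & forall g, normc (mu g) <= k.
  by exists `|k0| => // g; apply: le_trans (hk0 g) _; exact: ler_norm.
have mk g h := dotr_kernel_le g h k_ge0 hk.
have e : bdotr op w (bidual_emb b) mu = fun g => pair (dotr op w mu (delta g)) b.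
  by apply: funext => g; rewrite /bdotr bidual_embE//; exists (4 * k) => h; exact: mk.
rewrite e bidual_embE//; eexists => g; exact: (pair_le (mk g)).
Qed.

(** The coefficient at [k] of the product of [delta g] and [delta h]. By cancellativity each row and
    each column of this matrix has at most one nonzero entry, so all of them lie in [c_0]. *)
Let kern k g h : C := dotr op w (delta k) (delta g) h.

Let kernE k g h : kern k g h = (Defs.Omega op w g h)%:C * delta (op g h) k.
Proof.
have [hg _] := delta_l1 R g; have [hh _] := delta_l1 R h.
have hc := conv_l1 w_gt0 w_sub hg hh.
by rewrite /kern /dotr (pair_deltal _ hc) conv_delta.
Qed.

Let kern_le k g h : normc (kern k g h) <= 1.
Proof.
by rewrite kernE; apply: le_trans (normc_Omega_le w_gt0 w_sub _ _ _) (delta_le1 _ _ _).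
Qed.

Let kern_c0r k g : Defs.c0 (kern k g).
Proof.
move=> e e0; apply: sub_finite_set (finite_preimage (f := op g) _ (finite_set1 k)).
  move=> h eh; apply: contrapT => gh; have : e <= normc (kern k g h) := eh.
  rewrite kernE /Defs.delta.
  by case: eqP => [/esym//|_]; rewrite mulr0 normc0 leNgt e0.
by move=> ? ? _ _; case: (opC g) => + _; exact.
Qed.

Let kern_c0l k h : Defs.c0 (fun g => kern k g h).
Proof.
move=> e e0; apply: sub_finite_set (finite_preimage (f := fun g => op g h) _ (finite_set1 k)).
  move=> g eg; apply: contrapT => gh; have : e <= normc (kern k g h) := eg.
  rewrite kernE /Defs.delta.
  by case: eqP => [/esym//|_]; rewrite mulr0 normc0 leNgt e0.
by move=> ? ? _ _; case: (opC h) => _; exact.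
Qed.

Let kern_pair_c0 k b : l1 b -> Defs.c0 (fun g => pair (kern k g) b).
Proof.
move: b; apply: l1_ind.
- move=> e e0; apply: sub_finite_set (finite_set0 _) => g eg.
  have : e <= normc (pair (kern k g) (fun=> 0)) := eg.
  have bk : bounded (kern k g) by eexists; exact: kern_le.
  by rewrite (l1lin0 (l1lin_pair bk)) normc0 leNgt e0.
- move=> a b ha hb fa fb; have := c0D fa fb; congr Defs.c0.
  by apply: funext => g; rewrite (pairDr (kern_le k g)).
- move=> c a ha fa; have := c0Z c fa; congr Defs.c0.
  by apply: funext => g; rewrite (pairZr (kern_le k g)).
- move=> h; have := kern_c0l k h; congr Defs.c0.
  by apply: funext => g; rewrite pair_delta.
move=> a ha h; apply: c0_approx => e e0.
have e2 : 0 < e / 2 by rewrite divr_gt0.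
have [b [hb fb hab]] := h _ e2; exists (fun g => pair (kern k g) b) => // g.
have hba := l1B ha hb.
have -> : pair (kern k g) a = pair (kern k g) (fun g => a g - b g) + pair (kern k g) b.
  rewrite -(pairDr (kern_le k g))//; congr pair.
  by apply: funext => i; rewrite subrK.
by rewrite addrK; apply: le_trans (pair_le (kern_le k g) hba) _; lra.
Qed.

(** On a unit vector the first Arens product applies [Psi] to the rows of [kern] and then [Phi] to
    the resulting function. Both arguments lie in [c_0], where a functional is determined by its
    restriction. *)
Lemma bidual_restr_conv Phi Psi : bidual_mem Phi -> bidual_mem Psi ->
  bidual_restr (arens1 op w Phi Psi) = conv (bidual_restr Phi) (bidual_restr Psi).
Proof.
move=> mPhi mPsi; have [lPhi _] := bidual_restr_l1 mPhi.
have [lPsi _] := bidual_restr_l1 mPsi.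
apply: funext => k; rewrite {1}/bidual_restr /arens1 asboolT; last exact: delta_bounded.
have -> : bdotr op w Psi (delta k) = fun g => pair (kern k g) (bidual_restr Psi).
  by apply: funext => g; rewrite /bdotr (bidual_emb_restr mPsi (kern_c0r k g)).
rewrite (bidual_emb_restr mPhi (kern_pair_c0 k lPsi)).
rewrite -(pair_deltal k (conv_l1 w_gt0 w_sub lPhi lPsi)).
by rewrite dotr_bilin//; exact: delta_bounded.
Qed.

End product.
End Bidual.

(** * Transfer between [l^1(S, omega)] and its bidual *)

Section Equivalences.
Variables (R : realType) (S : choiceType) (op : S -> S -> S) (w : S -> R).
Hypothesis opC : cancellative op.
Hypothesis w_gt0 : forall s, 0 < w s.
Hypothesis w_sub : forall s t, w (op s t) <= w s * w t.
Local Notation C := R[i].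
Local Notation restr := (@bidual_restr R S).

(** For [f] in [c_0(S)] the pairing of [f] with [restr Phi] is [Phi f], and [f] also belongs to the
    predual [l^infty(S)] of the bidual; the same basic neighbourhoods therefore work. *)
Lemma wcont_restr (E : completeNormedModType C) (F : (S -> C) -> E -> C) :
  wcont (B := l1alg op w) (c0_predual R S) F ->
  wcont (B := bidual op w) (bidual_predual R S) (fun Phi => F (restr Phi)).
Proof.
move=> wF Phi0 m0 n xs e e0.
have [l0 _] := bidual_restr_l1 m0.
have [m [ps [d [d0 hps h]]]] := wF _ l0 n xs e e0.
have [f hf] := choice hps.
exists m, (fun i Phi => Phi (f i)), d; split => //.
  by move=> i; exists (f i); split => //; case: (hf i) => /c0_bounded.
move=> Phi mPhi hd j; have [lPhi _] := bidual_restr_l1 mPhi.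
apply: h => // i; have [f0 ->] := hf i.
by rewrite -!bidual_emb_restr//; exact: hd.
Qed.

(** Modules and derivations are pulled back along the homomorphism [restr]. As it is a left inverse
    of [bidual_emb], a functional implementing the pulled-back derivation implements the original
    one. *)
Lemma bidual_connes_amenable_restr :
  connes_amenable (bidual op w) (bidual_predual R S) ->
  connes_amenable (l1alg op w) (c0_predual R S).
Proof.
move=> ca E la ra [[h1 h2 h3 h4 [k h5]] h6] wc D [D1 D2 D3 D4] wcD.
have l1r Phi (m : bidual_mem Phi) : Defs.summable (restr Phi) := (bidual_restr_l1 m).1.
have [] := ca E (fun Phi x => la (restr Phi) x) (fun x Phi => ra x (restr Phi))
  _ _ (fun Phi => D (restr Phi)) _ (wcont_restr wcD).
- split; first split.
  + by move=> P Q x mP mQ; exact: (h1 _ _ x (l1r _ mP) (l1r _ mQ)).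
  + by move=> c P x mP; exact: (h2 c _ x (l1r _ mP)).
  + by move=> P x y mP; exact: (h3 _ x y (l1r _ mP)).
  + by move=> P c x mP; exact: (h4 _ c x (l1r _ mP)).
  + exists `|k| => P x mP; have [lP nP] := bidual_restr_l1 mP.
    have [e1 e2] := h5 _ x lP.
    have le : (k * Defs.l1norm (restr P))%:C * `|x| <= (`|k| * bidual_norm P)%:C * `|x|.
      rewrite ler_wpM2r// lecR; apply: (@le_trans _ _ (`|k| * Defs.l1norm (restr P))).
        by rewrite ler_wpM2r ?l1norm_ge0// ler_norm.
      by rewrite ler_wpM2l.
    by split; [exact: le_trans e1 le|exact: le_trans e2 le].
  + move=> P Q x mP mQ; rewrite /= bidual_restr_conv//.
    exact: (h6 _ _ x (l1r _ mP) (l1r _ mQ)).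
- move=> phi dphi; have [w1 w2] := wc phi dphi.
  by split; [exact: wcont_restr w1|exact: wcont_restr w2].
- split.
  + by move=> P mP; exact: (D1 _ (l1r _ mP)).
  + by move=> P Q mP mQ; exact: (D2 _ _ (l1r _ mP) (l1r _ mQ)).
  + by move=> c P mP; exact: (D3 c _ (l1r _ mP)).
  + move=> P Q mP mQ; rewrite /= bidual_restr_conv//.
    exact: (D4 _ _ (l1r _ mP) (l1r _ mQ)).
move=> phi [dphi hphi]; exists phi; split => // a ha.
have aE : restr (bidual_emb a) = a.
  apply: funext => g; rewrite /bidual_restr bidual_embE ?pair_deltal//.
  exact: delta_bounded.
have := hphi _ (bidual_emb_mem ha).
by rewrite /dl /dr /= aE.
Qed.

Lemma amenable_connes_amenable :
  amenable (l1alg op w) -> connes_amenable (l1alg op w) (c0_predual R S).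
Proof.
apply: (@dense_connes_amenable _ _ op w (l1alg op w) _ id) => //.
- by exists 1 => a ha; rewrite mul1r l1norm_ge0.
- by move=> p [f [f0 ->]]; apply: l1lin_pair; exact: c0_bounded.
- by move=> I p _ b hb; exists b.
Qed.

Lemma amenable_bidual_connes_amenable :
  amenable (l1alg op w) -> connes_amenable (bidual op w) (bidual_predual R S).
Proof.
apply: (@dense_connes_amenable _ _ op w (bidual op w) _ (@bidual_emb R S)).
- exact: bidual_emb_mem.
- move=> a b ha hb; apply: funext => mu; rewrite /bidual_emb /=.
  by case: asboolP => [[k hk]|_]; rewrite ?addr0// (pairDr hk).
- move=> c a ha; apply: funext => mu; rewrite /bidual_emb /=.
  by case: asboolP => [[k hk]|_]; rewrite ?mulr0// (pairZr hk).
- by move=> a b ha hb; exact: bidual_emb_conv.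
- by exists 2 => a ha; exact: bidual_emb_norm.
- move=> p [mu [bmu ->]].
  have -> : (fun a => bidual_emb a mu) = Defs.pair mu.
    by apply: funext => a; rewrite bidual_embE.
  exact: l1lin_pair.
move=> I p hp Phi mPhi; have [mu hmu] := choice hp.
have [a ha e] := @bidual_dense _ _ #|I| (fun i => mu (enum_val i)) Phi
  (fun i => (hmu (enum_val i)).1) mPhi.
exists a => // i; have [bmu ->] := hmu i.
by rewrite bidual_embE//; have := e (enum_rank i); rewrite enum_rankK.
Qed.

End Equivalences.

Theorem theorem5p16 (R : realType) (S : choiceType) (op : S -> S -> S) (w : S -> R) :
  associative op -> cancellative op -> ~ finite_set [set: S] -> is_weight op w ->
  (amenable (l1alg op w) <-> connes_amenable (l1alg op w) (c0_predual R S)) /\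
  (arens_regular op w ->
     (amenable (l1alg op w) <-> connes_amenable (bidual op w) (bidual_predual R S))) /\
  (amenable (l1alg op w) -> is_group op).
Proof.
move=> opA opC Sinf [w_gt0 w_sub w1].
have [s0 _] : exists s, [set: S] s.
  apply: contrapT => noS; apply: Sinf; apply: sub_finite_set (finite_set0 S) => s _.
  by case: noS; exists s.
have diag (ca : connes_amenable (l1alg op w) (c0_predual R S)) :=
  connes_amenable_virtual_diagonal opA opC w_gt0 w_sub s0 w1 ca.
have am : connes_amenable (l1alg op w) (c0_predual R S) -> amenable (l1alg op w).
  move=> /diag[u [uU [M vM]]].
  exact: (virtual_diagonal_amenable opA opC w_gt0 w_sub uU (w1 u uU) vM).
split; [|split].
- by split => //; exact: amenable_connes_amenable.
- move=> _; split; first exact: amenable_bidual_connes_amenable.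
  by move=> /(bidual_connes_amenable_restr opC w_gt0 w_sub).
- move=> /amenable_connes_amenable/diag[u [uU [M vM]]].
  exact: (virtual_diagonal_group opA opC w_gt0 w_sub uU (w1 u uU) vM).
Qed.
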